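(* Let $\mathcal{G}$ be a connected undirected graph on $N$ agents with Laplacian matrix $L\in\mathbb{R}^{N\times N}$, and let $\lambda_2(L)$ be the smallest nonzero eigenvalue of $L$. Let $g=g_p+g_q:\mathbb{R}^N\to\mathbb{R}^N$ be component-wisely sign-preserving with $g_p\in\mathcal{F}_p^{\sigma}$, $g_q\in\mathcal{F}_q^{\rho}$, where $p\in[0,1)$, $q>1$, $\sigma,\rho>0$. Then under the dynamics $\dot x=-g(Lx)$, $x(0)=x_0\in\mathbb{R}^N$, all the states achieve consensus in a fixed time $T(x_0)$ bounded by $$T(x_0)\le\frac{1}{\lambda_2(L)\sigma(1-p)}+\frac{1}{\lambda_2(L)\rho(q-1)}.$$
   Context: $x=[x_1,\dots,x_N]^T$, with $x_i\in\mathbb{R}$ the state of agent $i$. ''Consensus in time $T(x_0)$'' means $x(t)\in\mathrm{span}\{\mathbf{1}_N\}$ (all components equal) for all $t\ge T(x_0)$. For a measurable, locally essentially bounded map $X:\mathbb{R}^N\to\mathbb{R}^N$, the Filippov set-valued map is $\mathcal{F}[X](x)=\bigcap_{\delta>0}\bigcap_{\omega(\mathcal{N}_0)=0}\overline{co}\{X(x^{\delta}\setminus\mathcal{N}_0)\}$, where $x^\delta$ is the open ball of radius $\delta$ centered at $x$, $\omega$ is Lebesgue measure, and $\overline{co}$ is the closed convex hull. Solutions are Filippov solutions: (locally) absolutely continuous $x:[0,\infty)\to\mathbb{R}^N$ with $\dot x(t)\in\mathcal{F}[X](x(t))$ for a.e. $t$. A function $g:\mathbb{R}^N\to\mathbb{R}^N$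 is sign-preserving if $\mathrm{sign}(g(y))=\mathrm{sign}(y)$ (componentwise signum, $\mathrm{sign}(0)=0$) for all $y$; it is component-wisely sign-preserving if in addition $g(y)=[g_i(y_i)]_{i=1}^N$. For $p\ge0$ and $\sigma>0$, $g_p\in\mathcal{F}_p^{\sigma}$ means that $g_p$ is measurable, locally essentially bounded, sign-preserving, and $\min_{\eta\in\mathcal{F}[g_p](y)}\eta^Ty\ge\sigma\|y\|_2^{1+p}$ for all $y$. *)

(* Defs.v *)
From HB Require Import structures.
From mathcomp Require Import all_boot all_order all_algebra.
From mathcomp Require Import all_classical all_reals all_analysis.

Set Implicit Arguments.
Unset Strict Implicit.
Unset Printing Implicit Defensive.

Import Order.TTheory GRing.Theory Num.Theory numFieldNormedType.Exports.

Local Open Scope classical_set_scope.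
Local Open Scope ring_scope.

Section euclidean_space.
Context {R : realType} {N : nat}.
Implicit Types (x y : 'cV[R]_N) (S : set 'cV[R]_N) (X : 'cV[R]_N -> 'cV[R]_N).

Definition norm2 x : R := Num.sqrt (\sum_i (x i 0) ^+ 2).

(* The library's [ball] on matrices is the ball of the sup norm. *)
Definition eball x (r : R) : set 'cV[R]_N := [set y | norm2 (y - x) < r].

Definition box (a b : 'cV[R]_N) : set 'cV[R]_N :=
  [set x | forall i, a i 0 <= x i 0 <= b i 0].

Definition box_volume (a b : 'cV[R]_N) : R :=
  \prod_i Num.max (b i 0 - a i 0) 0.

(* Lebesgue outer measure on R^N.  It vanishes exactly on the Lebesgue null
   sets and agrees with Lebesgue measure on the Caratheodory measurable sets,
   which are the Lebesgue measurable ones. *)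
Definition lebesgue_outer S : \bar R :=
  ereal_inf [set mu | exists a b : nat -> 'cV[R]_N,
    S `<=` \bigcup_k box (a k) (b k) /\
    mu = (\sum_(0 <= k <oo) (box_volume (a k) (b k))%:E)%E].

Definition lebesgue_null S : Prop := lebesgue_outer S = 0%E.

Definition measurable_map X : Prop :=
  forall U : set 'cV[R]_N, open U -> lebesgue_outer.-caratheodory (X @^-1` U).

Definition locally_ess_bounded X : Prop :=
  forall x, exists r M : R, 0 < r /\
    exists2 N0, lebesgue_null N0 &
      forall y, (eball x r `\` N0) y -> norm2 (X y) <= M.

Definition closed_convex_hull S : set 'cV[R]_N :=
  \bigcap_(C in [set C : set 'cV[R]_N | [/\ closed C, convex_set C & S `<=` C]]) C.

Definition filippov X x : set 'cV[R]_N :=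
  \bigcap_(r in [set r : R | 0 < r]) \bigcap_(N0 in [set S | lebesgue_null S])
    closed_convex_hull (X @` (eball x r `\` N0)).

Definition abs_continuous_on (x : R -> 'cV[R]_N) (c d : R) : Prop :=
  forall eps : R, 0 < eps -> exists2 delta : R, 0 < delta &
    forall (n : nat) (a b : 'I_n -> R),
      (forall k, c <= a k <= b k /\ b k <= d) ->
      trivIset setT (fun k => `]a k, b k[%classic) ->
      \sum_k (b k - a k) < delta ->
      \sum_k norm2 (x (b k) - x (a k)) < eps.

(* A solution is a function on all of R of which only the values on [0, +oo[
   matter: the two-sided derivative at 0 concerns a null set of times. *)
Definition filippov_solution X (x : R -> 'cV[R]_N) : Prop :=
  (forall d : R, 0 <= d -> abs_continuous_on x 0 d) /\
  {ae lebesgue_measure, forall t : R, 0 <= t ->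
     derivable x t 1 /\ filippov X (x t) ('D_1 x t)}.

Definition sign_preserving (g : 'cV[R]_N -> 'cV[R]_N) : Prop :=
  forall y i, Num.sg (g y i 0) = Num.sg (y i 0).

Definition componentwise_sign_preserving (g : 'cV[R]_N -> 'cV[R]_N) : Prop :=
  sign_preserving g /\
  exists gi : 'I_N -> R -> R, forall y i, g y i 0 = gi i (y i 0).

(* The minimum of eta^T y over the compact set F[g](y) is at least c iff every
   eta in F[g](y) satisfies eta^T y >= c. *)
Definition class_F (p sigma : R) (g : 'cV[R]_N -> 'cV[R]_N) : Prop :=
  [/\ measurable_map g, locally_ess_bounded g, sign_preserving g &
      forall y eta, filippov g y eta ->
        sigma * norm2 y `^ (1 + p) <= (eta^T *m y) 0 0].

Definition consensus x : Prop := exists c : R, x = c *: const_mx 1.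

End euclidean_space.

Section graphs.
Context {R : realType} {N : nat}.
Implicit Types (A : 'M[R]_N).

(* Undirected graphs are given by their adjacency matrix; positive edge weights
   are allowed, and simple graphs are the matrices with entries in {0, 1}. *)
Definition undirected_graph A : Prop :=
  [/\ A^T = A, forall i j, 0 <= A i j & forall i, A i i = 0].

Definition connected_graph A : Prop :=
  forall i j, connect [rel k l | 0 < A k l] i j.

Definition laplacian A : 'M[R]_N :=
  diag_mx (\row_i \sum_j A i j) - A.

Definition smallest_nonzero_eigenvalue (L : 'M[R]_N) (lambda : R) : Prop :=
  [/\ eigenvalue L lambda, lambda != 0 &
      forall mu, eigenvalue L mu -> mu != 0 -> lambda <= mu].

End graphs.

(* Main.v *)
Require Import Defs.
From mathcomp Require Import all_boot all_order all_algebra.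
From mathcomp Require Import all_classical all_reals all_analysis.
From mathcomp Require Import measurable_realfun.
From mathcomp Require Import ring lra.
Import Order.TTheory GRing.Theory Num.Theory numFieldNormedType.Exports.

(** The energy [e = lambda2 (x, L x)] decreases along every solution until it
    vanishes. With [y = L x], an element [eta] of the Filippov set of
    [z |-> - g (L z)] at [x] satisfies
    [(eta, y) <= - (sigma |y|^(1+p) + rho |y|^(1+q))], and the spectral gap
    [lambda2 (x, L x) <= |L x|^2] turns this into
    [e' <= - 2 lambda2 (sigma e^((1+p)/2) + rho e^((1+q)/2))] almost everywhere.
    Dropping the first term, [e^((1-q)/2)] grows at least linearly, so [e <= 1]
    after time [1 / (lambda2 rho (q-1))] whatever the initial state; dropping
    the second term, [e^((1-p)/2)] then decreases at least linearly and reaches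
    [0] within time [1 / (lambda2 sigma (1-p))]. The kernel of the form
    [(x, L x)] of a connected graph consists of the consensus states. The
    bound does not depend on the solution, so it serves as [T] itself.

    The delicate point is the bound on [(eta, y)]. A Filippov set ignores null
    sets, the image of the singular matrix [L] is a null set, and the hypotheses
    on [gp] and [gq] only speak of Filippov sets of maps that are not composed
    with [L]. The bound on the Filippov set of [gp] at [y] first gives
    [(gp z, y) >= sigma |y|^(1+p) - eps] for almost every [z] near [y]
    ([filippov_ess_lower_bound]), similarly for [gq], and the two add up to a
    bound on [g]. As [g] acts componentwise, this is a bound on a sum of
    functions of separate variables. Non-null subsets of the line have a non-null product
    ([lebesgue_nonnull_product]), so the bound splits into almost everywhere
    bounds on the single terms ([separable_ess_lower_bound]). A null set of the
    line pulls back to a null set along each row of [L], which is nonzero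
    ([lebesgue_null_linear_preimage]), and the bounds on the terms give the
    bound on [g (L z)] for almost every [z] near [x] ([filippov_comp_mulmx]).

    The passage from almost everywhere differential inequalities to inequalities
    between values of [e] is [absolutely_continuous_growth], proved by an
    induction along the time interval. *)

Set Implicit Arguments.
Unset Strict Implicit.
Unset Printing Implicit Defensive.

Local Open Scope classical_set_scope.
Local Open Scope ring_scope.
Local Open Scope convex_scope.

(** * Null sets of Euclidean space *)

Section lebesgue_outer.
Context {R : realType} {n : nat}.
Local Notation vec := 'cV[R]_n.+1.
Implicit Types (a b : vec) (S : set vec).

Lemma box_volume_ge0 a b : 0 <= box_volume a b.
Proof. by apply: prodr_ge0 => i _; rewrite le_max lexx orbT. Qed.

Lemma box_volume_point a : box_volume a a = 0.
Proof. by rewrite /box_volume big_ord_recl subrr maxxx mul0r. Qed.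

Lemma lebesgue_outer_ge0 S : (0 <= lebesgue_outer S)%E.
Proof.
apply: le_ereal_inf_tmp => _ [a [b [_ ->]]]; apply: nneseries_ge0 => k _ _.
by rewrite lee_fin box_volume_ge0.
Qed.

Lemma le_lebesgue_outer S S' :
  S `<=` S' -> (lebesgue_outer S <= lebesgue_outer S')%E.
Proof.
move=> SS'; apply: le_ereal_inf_tmp => _ [a [b [Sab ->]]].
by apply: ereal_inf_lbound; exists a, b; split=> //; apply: subset_trans Sab.
Qed.

(** The family is enumerated by a sequence whose unused entries are degenerate
    boxes; these have volume zero because the dimension is positive. *)
Lemma lebesgue_outer_le_esum (T : countType) (a b : T -> vec) S :
  S `<=` \bigcup_t box (a t) (b t) ->
  (lebesgue_outer S <= \esum_(t in [set: T]) (box_volume (a t) (b t))%:E)%E.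
Proof.
move=> Sab; pose c (f : T -> vec) k : vec := oapp f 0 (pickle_inv k).
apply: (@le_trans _ _
    (\sum_(0 <= k <oo) (box_volume (c a k) (c b k))%:E)%E).
  apply: ereal_inf_lbound; exists (c a), (c b); split=> // z /Sab[t _ zt].
  by exists (pickle t) => //; rewrite /c pickleK_inv.
rewrite nneseries_esumT; last by move=> k; rewrite lee_fin box_volume_ge0.
pose F k := (box_volume (c a k) (c b k))%:E.
rewrite (eq_esum (b := F \o pickle)); last first.
  by move=> t _; rewrite /F/= /c pickleK_inv.
rewrite -(@esum_image _ _ _ [set: T] pickle F); last first.
  by move=> t t' _ _; exact: (pcan_inj pickleK).
rewrite [leRHS]esum_mkcond; apply: le_esum => k _; rewrite -/(F k).
case: ifPn => //; rewrite notin_setE /F /c => /= nk.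
case E: (pickle_inv k) => [t|] /=; last by rewrite box_volume_point.
by exfalso; apply: nk; exists t => //; have := @pickle_invK T k; rewrite E.
Qed.

Lemma lebesgue_outer_sigma_subadditive (S : (set vec)^nat) :
  (lebesgue_outer (\bigcup_k S k) <= \sum_(0 <= k <oo) lebesgue_outer (S k))%E.
Proof.
have [[i ioo]|] := pselect (exists i, lebesgue_outer (S i) = +oo%E).
  rewrite (eseries_pinfty _ _ ioo) ?leey// => k _.
  by rewrite -ltNye (lt_le_trans _ (lebesgue_outer_ge0 _)).
rewrite -forallNE => Soo; apply/lee_addgt0Pr => e e0.
apply: le_trans (epsilon_trick xpredT _ (ltW e0)); last first.
  by move=> k; exact: lebesgue_outer_ge0.
pose P k (ab : (nat -> vec) * (nat -> vec)) :=
  S k `<=` \bigcup_j box (ab.1 j) (ab.2 j) /\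
  (\sum_(0 <= j <oo) (box_volume (ab.1 j) (ab.2 j))%:E <=
     lebesgue_outer (S k) + (e / (2 ^ k.+1)%:R)%:E)%E.
have [G PG] : {G : nat -> _ & forall k, P k (G k)}.
  apply: (@choice _ _ P) => k.
  have fk : lebesgue_outer (S k) \is a fin_num.
    rewrite ge0_fin_numE ?lebesgue_outer_ge0//.
    by rewrite lt_neqAle leey andbT; apply/eqP/Soo.
  have ek : 0 < e / (2 ^ k.+1)%:R by rewrite divr_gt0// ltr0n expn_gt0.
  have [_ [a [b [Sab ->]]] ab] := lb_ereal_inf_adherent ek fk.
  by exists (a, b); split => //; apply: ltW.
apply: (@le_trans _ _ (\esum_(t in [set: nat * nat])
  (box_volume ((G t.1).1 t.2) ((G t.1).2 t.2))%:E)%E).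
  apply: (@lebesgue_outer_le_esum (nat * nat)%type
    (fun t => (G t.1).1 t.2) (fun t => (G t.1).2 t.2)).
  by move=> z [k _ /(PG k).1[j _ zj]]; exists (k, j).
rewrite (_ : [set: nat * nat] = [set: nat] `*`` (fun=> [set: nat])); last first.
  by apply/seteqP; split.
rewrite -(@esum_esum _ _ _ _ _
  (fun k j => (box_volume ((G k).1 j) ((G k).2 j))%:E)); last first.
  by move=> k j _ _; rewrite lee_fin box_volume_ge0.
rewrite -nneseries_esumT; last first.
  by move=> k; apply: esum_ge0 => j _; rewrite lee_fin box_volume_ge0.
apply: lee_nneseries => [k _ _|k _].
  by apply: esum_ge0 => j _; rewrite lee_fin box_volume_ge0.
rewrite -nneseries_esumT; first exact: (PG k).2.
by move=> j; rewrite lee_fin box_volume_ge0.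
Qed.

Lemma lebesgue_nullS S S' : S `<=` S' -> lebesgue_null S' -> lebesgue_null S.
Proof.
move=> SS' S'0; apply/eqP; rewrite eq_le lebesgue_outer_ge0 andbT -S'0.
exact: le_lebesgue_outer.
Qed.

Lemma lebesgue_null_bigcup (S : (set vec)^nat) :
  (forall k, lebesgue_null (S k)) -> lebesgue_null (\bigcup_k S k).
Proof.
move=> S0; apply/eqP; rewrite eq_le lebesgue_outer_ge0 andbT.
apply: (le_trans (lebesgue_outer_sigma_subadditive S)).
by rewrite eseries0// => k _ _; exact: S0.
Qed.

Lemma lebesgue_null0 : lebesgue_null (set0 : set vec).
Proof.
apply/eqP; rewrite eq_le lebesgue_outer_ge0 andbT.
apply: (@le_trans _ _ (\sum_(0 <= k <oo) (box_volume (0 : vec) 0)%:E)%E).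
  by apply: ereal_inf_lbound; exists (fun=> 0), (fun=> 0); split.
by rewrite box_volume_point eseries0.
Qed.

Lemma lebesgue_nullU S S' :
  lebesgue_null S -> lebesgue_null S' -> lebesgue_null (S `|` S').
Proof.
move=> S0 S'0; rewrite -bigcup2E; apply: lebesgue_null_bigcup.
by move=> [|[|k]] //=; exact: lebesgue_null0.
Qed.

Lemma lebesgue_null_bigcup_fin (I : finType) (S : I -> set vec) :
  (forall i, lebesgue_null (S i)) -> lebesgue_null (\bigcup_i S i).
Proof.
move=> S0; apply: (@lebesgue_nullS _
  (\bigcup_k (oapp S set0 (unpickle k)))) => [z [i _ zi]|].
  by exists (pickle i) => //; rewrite pickleK.
apply: lebesgue_null_bigcup => k.
by case: (unpickle k) => [i|] /=; [exact: S0 | exact: lebesgue_null0].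
Qed.

End lebesgue_outer.

(** * Preimages of null sets under linear functionals *)

Lemma esum_finType {R : realType} (T : finType) (F : T -> R) :
  (forall t, 0 <= F t) -> (\esum_(t in [set: T]) (F t)%:E = (\sum_t F t)%:E)%E.
Proof.
move=> F0; rewrite esum_fset; last 2 first.
- exact: finite_finset.
- by move=> t _; rewrite lee_fin.
rewrite -sumEFin (@fsbigE _ _ _ _ _ (index_enum T))//=.
- by under eq_bigl do rewrite in_setT.
- exact: index_enum_uniq.
- by move=> t _; rewrite mem_index_enum.
Qed.

Section linear_preimage.
Context {R : realType} {n : nat}.
Local Notation vec := 'cV[R]_n.+1.
Variables (l : 'I_n.+1 -> R) (j : 'I_n.+1).
Hypothesis lj0 : l j != 0.

Let cube K : set vec := [set z | forall i, - K <= z i 0 < K].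

Let slab (c r : R) : set vec := [set z | `|\sum_i l i * z i 0 - c| <= r].

Let slab_constant (K : R) : R := (2 * K) ^+ n * 4 / `|l j|.

Let slab_constant_ge0 K : 0 < K -> 0 <= slab_constant K.
Proof. by move=> K0; rewrite /slab_constant divr_ge0// mulr_ge0// exprn_ge0//; lra. Qed.

(** The coordinates other than [j] of the cube are cut into a grid of step [h].
    Over a cell of the grid, the slab is contained in a box of thickness
    [2 (r + s h) / |l j|], which is at most [4 r / |l j|] for a fine grid. *)
Lemma lebesgue_outer_slab (K c r : R) : 0 < K -> 0 < r ->
  (lebesgue_outer (cube K `&` slab c r) <=
   (slab_constant K * r)%:E)%E.
Proof.
move=> K0 r0; pose s := \sum_i `|l (lift j i)|.
have s0 : 0 <= s by apply: sumr_ge0.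
pose m := (Num.truncn (s * (2 * K) / r)).+1.
have m0 : 0 < m%:R :> R by rewrite ltr0n.
pose h := 2 * K / m%:R.
have h0 : 0 < h by rewrite /h divr_gt0//; lra.
have shr : s * h <= r.
  rewrite /h mulrA ler_pdivrMr// [leRHS]mulrC -ler_pdivrMr//.
  exact/ltW/truncnS_gt.
have lj : 0 < `|l j| by rewrite normr_gt0.
pose rho := (2 * r) / `|l j|.
(* [u] runs over the cells of the grid; [mid u] is the value of coordinate [j]
   at which the functional equals [c] above the corner of the cell. *)
pose corner (u : {ffun 'I_n -> 'I_m}) i : R := - K + h * (u i)%:R.
pose mid u := (c - \sum_i l (lift j i) * corner u i) / l j.
pose lo u : vec := \col_i oapp (corner u) (mid u - rho) (unlift j i).
pose hi u : vec := \col_i oapp (fun k => corner u k + h) (mid u + rho) (unlift j i).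
have cover : cube K `&` slab c r `<=`
    \bigcup_u box (lo u) (hi u).
  move=> z [zK zr].
  have zh i : 0 <= (z i 0 + K) / h.
    by rewrite divr_ge0// ?(ltW h0)//; have := zK i; lra.
  have um i : (Num.truncn ((z (lift j i) 0 + K) / h)%R < m)%N.
    rewrite truncn_lt_nat// /h invf_div mulrA ltr_pdivrMr; last lra.
    by rewrite mulrC ltr_pM2l//; have := zK (lift j i); lra.
  pose u := [ffun i => Ordinal (um i)].
  have cornerP i : corner u i <= z (lift j i) 0 <= corner u i + h.
    rewrite /corner ffunE/=; have := truncn_itv (zh (lift j i)).
    set t := Num.truncn _; rewrite ler_pdivlMr// ltr_pdivrMr// -natr1.
    by move=> /andP[]; lra.
  exists u => // i; rewrite /lo /hi !mxE; case: unliftP => [k ->|->] /=; first exact: cornerP.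
  rewrite -ler_distl /rho ler_pdivlMr// -normrM.
  have -> : (z j 0 - mid u) * l j = (\sum_i l i * z i 0 - c)
      - \sum_i l (lift j i) * (z (lift j i) 0 - corner u i).
    rewrite (bigD1_ord j)//= /mid mulrBl divfK//.
    under [X in _ = _ - X]eq_bigr do rewrite mulrBr.
    by rewrite sumrB; ring.
  apply: (le_trans (ler_normB _ _)); rewrite -[2 * r]/((1 + 1) * r) mulrDl mul1r.
  apply: lerD => //; apply: le_trans shr; rewrite mulr_suml.
  apply: (le_trans (ler_norm_sum _ _ _)); apply: ler_sum => k _.
  rewrite normrM ler_wpM2l// ler_distl.
  by have := cornerP k; lra.
apply: (le_trans (lebesgue_outer_le_esum cover)).
rewrite esum_finType => [|u]; last exact: box_volume_ge0.
rewrite lee_fin (eq_bigr (fun=> rho *+ 2 * h ^+ n)) => [|u _].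
  rewrite sumr_const card_ffun !card_ord -[leLHS]mulr_natl natrX.
  rewrite mulrCA -exprMn /h (mulrC m%:R) divfK ?gt_eqF//.
  by rewrite /slab_constant /rho le_eqVlt; apply/orP; left; apply/eqP; ring.
rewrite /box_volume (bigD1_ord j)//= !mxE unlift_none/=.
congr (_ * _).
  rewrite max_l; first by ring.
  by rewrite opprD addrACA subrr add0r opprK addr_ge0// divr_ge0// ?mulr_ge0// ltW.
rewrite -[in RHS](card_ord n) -prodr_const; apply: eq_bigr => i _.
by rewrite !mxE liftK/= addrC addKr max_l// ltW.
Qed.

(** An interval of length [r] pulls back to a slab, of which the part in a
    bounded cube is covered by boxes of total volume [O(r)]. *)
Lemma lebesgue_null_linear_preimage (Z : set R) :
  lebesgue_measure.-negligible Z ->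
  lebesgue_null [set z : vec | Z (\sum_i l i * z i 0)].
Proof.
move=> /negligible_outer_measure; rewrite outer_measure_open_itv_cover => Z0.
pose P := [set z : vec | Z (\sum_i l i * z i 0)].
have cubeT : P `<=` \bigcup_k (cube k.+1%:R `&` P).
  move=> z Pz; pose k := (\max_i Num.truncn `|z i 0|%R)%N.
  exists k => //; split => // i.
  have : `|z i 0| < k.+1%:R.
    apply: (lt_le_trans (truncnS_gt _)); rewrite ler_nat ltnS.
    exact: leq_bigmax.
  by rewrite ltr_norml => /andP[/ltW -> ->].
apply: lebesgue_nullS cubeT _; apply: lebesgue_null_bigcup => k.
have K0 : 0 < k.+1%:R :> R by rewrite ltr0n.
apply/eqP; rewrite eq_le lebesgue_outer_ge0 andbT.
apply/lee_addgt0Pr => e e0; rewrite add0e.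
set C := slab_constant k.+1%:R.
have C0 : 0 <= C by exact: slab_constant_ge0.
have d0 : 0 < e / (C + 1) by rewrite divr_gt0// ltr_wpDl.
move: Z0; set I := ereal_inf _ => Z0.
have finI : I \is a fin_num by rewrite Z0.
have := lb_ereal_inf_adherent d0 finI; rewrite -/I Z0 add0e.
move=> [_ [F [Fitv ZF] <-]] Fd.
pose S i := cube k.+1%:R `&` [set z : vec | F i (\sum_i l i * z i 0)].
have PS : cube k.+1%:R `&` P `<=` \bigcup_i S i.
  by move=> z [zK /ZF[i _ Fi]]; exists i.
apply: (le_trans (le_lebesgue_outer PS)).
apply: (le_trans (lebesgue_outer_sigma_subadditive S)).
have F0 i : (0 <= wlength idfun (F i))%E.
  by case: (Fitv i) => -[a b] /= ->; exact: wlength_ge0.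
apply: (@le_trans _ _ (\sum_(0 <= i <oo) (C%:E * wlength idfun (F i)))%E).
  apply: lee_nneseries => [i _ _|i _]; first exact: lebesgue_outer_ge0.
  rewrite /S; case: (Fitv i) => -[a b] /= ->; rewrite wlength_itv/= lte_fin.
  case: ifPn => [ab|]; last first.
    rewrite -leNgt => ba; rewrite (_ : _ `&` _ = set0) ?lebesgue_null0 ?mule0//.
    apply/seteqP; split => // z [_] /=; rewrite in_itv/=.
    by move=> /andP[/lt_trans/[apply]]; rewrite ltNge ba.
  apply: (@le_trans _ _ (C * ((b - a) / 2))%:E).
    apply: le_trans (@lebesgue_outer_slab k.+1%:R ((a + b) / 2) _ K0 _); last lra.
    apply: le_lebesgue_outer => z [zK /=]; rewrite in_itv/= => ab'.
    by split => //; rewrite /slab/= ler_distl; lra.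
  by rewrite -EFinD -EFinM lee_fin ler_wpM2l//; lra.
rewrite nneseriesZl//; apply: (@le_trans _ _ (C%:E * (e / (C + 1))%:E)%E).
  by apply: lee_pmul => //; [exact: nneseries_ge0 | exact: ltW].
rewrite -EFinM lee_fin mulrCA ger_pMr// ler_pdivrMr//; lra.
Qed.

End linear_preimage.

(** * Products of non-null sets *)

Section product_of_nonnull_sets.
Context {R : realType}.
Local Notation mu := (@lebesgue_measure R).
Local Notation outer := (mu_ext (@wlength R idfun)).

(** [S] need not be measurable: it lies in a superlevel set of the sum of
    weighted indicators, to which Chebyshev's inequality applies. *)
Lemma outer_chebyshev (S : set R) (alpha beta : R) (w a b : nat -> R) :
  (forall k, 0 <= w k) -> 0 < alpha -> (beta%:E <= outer S)%E ->
  (forall s, S s ->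
    alpha%:E <= \sum_(0 <= k <oo) (w k * (a k <= s <= b k)%R%:R)%:E)%E ->
  ((alpha * beta)%:E <=
    \sum_(0 <= k <oo) (w k * Num.max (b k - a k) 0)%:E)%E.
Proof.
move=> w0 alpha0 betaS Sw.
pose f k s := ((w k)%:E * (\1_(`[a k, b k]%classic : set R) s)%:E)%E.
have fE k s : f k s = (w k * (a k <= s <= b k)%R%:R)%:E.
  by rewrite /f -EFinM indicE mem_setE in_itv.
have f0 k s : (0 <= f k s)%E by rewrite fE lee_fin mulr_ge0.
have mf k : measurable_fun setT (f k).
  apply: emeasurable_funM; first exact: measurable_cst.
  by apply/measurable_EFinP; apply: measurable_indic.
pose g s := (\sum_(0 <= k <oo) f k s)%E.
have g0 s : (0 <= g s)%E by apply: nneseries_ge0.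
have mg : measurable_fun setT g.
  rewrite (_ : g = fun s => (\sum_(k <oo | k \in xpredT) f k s)%E)//.
  exact: ge0_emeasurable_sum.
have := @le_integral_abse _ _ R mu setT measurableT g alpha mg alpha0.
under eq_integral do rewrite (gee0_abs (g0 _)).
rewrite integral_nneseries//= setTI => le_int.
apply: (@le_trans _ _
  (alpha%:E * mu [set x | (alpha%:E <= `|g x|)%E])%E).
  rewrite EFinM lee_pmul2l//; apply: (le_trans betaS).
  apply: le_outer_measure => s /Sw; rewrite /= (gee0_abs (g0 _)) /g.
  by under [X in (_ -> (_ <= X)%E)]eq_eseriesr do rewrite fE.
apply: (le_trans le_int).
have -> // : (\sum_(0 <= k <oo) \int[mu]_x f k x =
  \sum_(0 <= k <oo) (w k * Num.max (b k - a k) 0)%:E)%E.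
apply: eq_eseriesr => k _; rewrite ge0_integralZl_EFin//; last first.
  by apply/measurable_EFinP; apply: measurable_indic.
rewrite integral_indic// setIT [X in (_ * X)%E]lebesgue_measure_itv/= lte_fin EFinM.
congr (_ * _)%E; case: ifPn => [ab|]; first by rewrite max_l// subr_ge0 ltW.
by rewrite -leNgt => ba; rewrite max_r// subr_le0.
Qed.

(** Freezing all coordinates but the last turns the boxes of a cover into
    weighted intervals for [outer_chebyshev]; the weights [w] make the resulting
    inequality an instance of the same statement with one factor less. *)
Lemma outer_product_le (S : nat -> set R) (beta : nat -> R) (n : nat) :
  (forall i, 0 < beta i) -> (forall i, (beta i)%:E <= outer (S i))%E ->
  forall (w : nat -> R) (a b : nat -> nat -> R) (alpha : R),
  (forall k, 0 <= w k) -> 0 < alpha ->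
  (forall f : nat -> R, (forall i, S i (f i)) ->
    alpha%:E <= \sum_(0 <= k <oo)
      (w k * \prod_(i < n) (a k i <= f i <= b k i)%R%:R)%:E)%E ->
  ((alpha * \prod_(i < n) beta i)%:E <= \sum_(0 <= k <oo)
      (w k * \prod_(i < n) Num.max (b k i - a k i) 0)%:E)%E.
Proof.
move=> beta0 betaS; have [f0 Sf0] : exists f : nat -> R, forall i, S i (f i).
  have /choice : forall i, exists s, S i s.
    move=> i; apply: contrapT => /forallNP Si0.
    have := betaS i; rewrite (_ : S i = set0) ?outer_measure0.
      by rewrite lee_fin leNgt beta0.
    by apply/seteqP; split => // s /Si0.
  by move=> [f Sf]; exists f.
elim: n => [|n IH] w a b alpha w0 alpha0 Sw.
  rewrite big_ord0 mulr1; have := Sw _ Sf0.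
  under [X in (_ <= X)%E -> _]eq_eseriesr do rewrite big_ord0.
  by under [X in _ -> (_ <= X)%E]eq_eseriesr do rewrite big_ord0.
rewrite big_ord_recr/= [X in alpha * X]mulrC mulrA.
under eq_eseriesr do
  rewrite big_ord_recr/= [X in (_ * X)%R]mulrC mulrA.
apply: IH => [k||f Sf].
- by rewrite mulr_ge0// le_max lexx orbT.
- by rewrite mulr_gt0.
pose w' k := w k * \prod_(i < n) (a k i <= f i <= b k i)%R%:R.
under eq_eseriesr do rewrite mulrAC.
apply: (@outer_chebyshev (S n) alpha (beta n) w' (a ^~ n) (b ^~ n)) => //.
  by move=> k; rewrite /w' mulr_ge0// prodr_ge0.
move=> s Ss; pose f' i := if i == n then s else f i.
have Sf' i : S i (f' i) by rewrite /f'; case: eqP => [->|].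
have f'n : f' n = s by rewrite /f' eqxx.
have f'i (i : 'I_n) : f' i = f i by rewrite /f' ltn_eqF.
have := Sw f' Sf'.
under [X in (_ <= X)%E -> _]eq_eseriesr => k _.
  rewrite big_ord_recr/= f'n mulrA.
  rewrite (eq_bigr (fun i : 'I_n => (a k i <= f i <= b k i)%R%:R)).
    over.
  by move=> i _; rewrite f'i.
by [].
Qed.

End product_of_nonnull_sets.

(** Any cover of the product by boxes has total volume at least the product of
    the outer measures of the factors, whether or not these are measurable. *)
Lemma lebesgue_nonnull_product {R : realType} {n : nat}
    (S : 'I_n.+1 -> set R) :
  (forall i, ~ lebesgue_measure.-negligible (S i)) ->
  ~ lebesgue_null [set z : 'cV[R]_n.+1 | forall i, S i (z i 0)].
Proof.
move=> Snn; rewrite /lebesgue_null => null.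
pose T i := S (inord i).
have [beta betaP] : exists beta : nat -> R, forall i,
    0 < beta i /\ ((beta i)%:E <= mu_ext (@wlength R idfun) (T i))%E.
  suff /choice[beta betaP] : forall i, exists b : R,
    0 < b /\ (b%:E <= mu_ext (@wlength R idfun) (T i))%E by exists beta.
  move=> i.
  have := Snn (inord i); rewrite negligible_outer_measure -/(T i) => T0.
  have : (0 <= mu_ext (@wlength R idfun) (T i))%E by exact: outer_measure_ge0.
  case: (mu_ext _ _) T0 => [r r0|_ _|//].
    rewrite lee_fin le_eqVlt => /orP[/eqP r0'|r0'].
      by exfalso; apply: r0; rewrite -r0'.
    by exists r.
  by exists 1; rewrite leey.
have beta0 i : 0 < beta i by case: (betaP i).
have betaT i : ((beta i)%:E <= mu_ext (@wlength R idfun) (T i))%E.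
  by case: (betaP i).
have p0 : 0 < \prod_(i < n.+1) beta i by apply: prodr_gt0.
move: null; rewrite /lebesgue_outer; set I := ereal_inf _ => I0.
have finI : I \is a fin_num by rewrite I0.
have := lb_ereal_inf_adherent p0 finI; rewrite -/I I0 add0e.
move=> [_ [a [b [Sab ->]]]]; apply/negP; rewrite -leNgt.
have := @outer_product_le R T beta n.+1 beta0 betaT (fun=> 1)
  (fun k i => a k (inord i) 0) (fun k i => b k (inord i) 0) 1.
rewrite mul1r; under [X in _ -> (_ <= X)%E]eq_eseriesr => k _.
  rewrite mul1r (eq_bigr (fun i => Num.max (b k i 0 - a k i 0) 0)).
    over.
  by move=> i _; rewrite inord_val.
apply => // f Tf; pose z : 'cV[R]_n.+1 := \col_i f i.
have [k _ zk] : (\bigcup_k box (a k) (b k)) z.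
  by apply: Sab => i; rewrite mxE; have := Tf i; rewrite /T inord_val.
apply: le_trans (nneseries_lim_ge k.+1 _); last first.
  by move=> j _ _; rewrite lee_fin mul1r prodr_ge0.
rewrite big_nat_recr//= [X in (_ <= _ + X)%E](_ : _ = 1%:E); last first.
  rewrite mul1r big1// => i _; rewrite inord_val.
  by have := zk i; rewrite mxE => ->.
by rewrite leeDr// sume_ge0// => j _; rewrite lee_fin mul1r prodr_ge0.
Qed.

(** * Inner product, half-spaces and compact sets *)

Local Notation dot u v := ((u^T *m v) 0 0).

Section euclidean_space.
Context {R : realType} {N : nat}.
Implicit Types (u v y : 'cV[R]_N).

Lemma dotE u v : dot u v = \sum_i u i 0 * v i 0.
Proof. by rewrite mxE; apply: eq_bigr => i _; rewrite mxE. Qed.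

Lemma dotC u v : dot u v = dot v u.
Proof. by rewrite !dotE; apply: eq_bigr => i _; rewrite mulrC. Qed.

Lemma dotDl u v y : dot (u + v) y = dot u y + dot v y.
Proof. by rewrite linearD mulmxDl mxE. Qed.

Lemma dotZl (k : R) u y : dot (k *: u) y = k * dot u y.
Proof. by rewrite linearZ/= -scalemxAl mxE. Qed.

Lemma dotNl u y : dot (- u) y = - dot u y.
Proof. by rewrite linearN/= mulNmx mxE. Qed.

Lemma dotDr u v y : dot u (v + y) = dot u v + dot u y.
Proof. by rewrite dotC dotDl !(dotC _ u). Qed.

Lemma dotZr (k : R) u v : dot u (k *: v) = k * dot u v.
Proof. by rewrite dotC dotZl dotC. Qed.

Lemma dotNr u v : dot u (- v) = - dot u v.
Proof. by rewrite dotC dotNl dotC. Qed.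

Lemma dot_ge0 u : 0 <= dot u u.
Proof. by rewrite dotE sumr_ge0// => i _; rewrite -expr2 sqr_ge0. Qed.

Lemma dot_eq0 u : dot u u = 0 -> u = 0.
Proof.
rewrite dotE => /eqP; rewrite psumr_eq0 => [/allP u0|i _].
  apply/colP => i; have := u0 i (mem_index_enum i).
  by rewrite mulf_eq0 orbb mxE => /eqP.
by rewrite -expr2 sqr_ge0.
Qed.

Lemma norm2_sqr u : norm2 u ^+ 2 = dot u u.
Proof.
rewrite /norm2 sqr_sqrtr ?sumr_ge0// => [|i _]; last exact: sqr_ge0.
by rewrite dotE; apply: eq_bigr => i _; rewrite expr2.
Qed.

Lemma norm2_ge0 u : 0 <= norm2 u.
Proof. exact: sqrtr_ge0. Qed.

Lemma coord_le_norm2 u i : `|u i 0| <= norm2 u.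
Proof.
rewrite /norm2 -sqrtr_sqr ler_wsqrtr// (bigD1 i)//= lerDl sumr_ge0// => j _.
exact: sqr_ge0.
Qed.

Lemma norm2_le_sum u : norm2 u <= \sum_i `|u i 0|.
Proof.
have s0 : 0 <= \sum_i `|u i 0| by exact: sumr_ge0.
rewrite -(ler_pXn2r (ltn0Sn 1)) ?nnegrE ?norm2_ge0// norm2_sqr dotE expr2.
rewrite mulr_suml; apply: ler_sum => i _.
apply: le_trans (_ : `|u i 0| * `|u i 0| <= _); first by rewrite -normrM ler_norm.
by rewrite ler_wpM2l// (bigD1 i)//= lerDl sumr_ge0.
Qed.

Lemma dot_continuous y : continuous (fun v => dot v y).
Proof.
have -> : (fun v => dot v y) = (fun v : 'cV[R]_N => \sum_i v i 0 * y i 0).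
  by apply/funext => v; rewrite dotE.
apply: continuous_big => [z|i _ z]; first exact: add_continuous.
apply: (@continuousM _ _ (fun v : 'cV[R]_N => v i 0)).
  exact: coord_continuous.
exact: cst_continuous.
Qed.

Lemma dot_diag_continuous (M : 'M[R]_N) : continuous (fun v => dot v (M *m v)).
Proof.
have -> : (fun v => dot v (M *m v)) =
    (fun v : 'cV[R]_N => \sum_i v i 0 * \sum_j M i j * v j 0).
  apply/funext => v; rewrite dotE; apply: eq_bigr => i _.
  by rewrite [in LHS]mxE.
apply: continuous_big => [z|i _ z]; first exact: add_continuous.
apply: (@continuousM _ _ (fun v : 'cV[R]_N => v i 0)).
  exact: coord_continuous.
apply: continuous_big => [w|j _ w]; first exact: add_continuous.
apply: (@continuousM _ _ (fun=> M i j)); first exact: cst_continuous.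
exact: coord_continuous.
Qed.

Lemma compact_coord_bounded (M : R) :
  compact [set v : 'cV[R]_N | forall i, `|v i 0| <= M].
Proof.
have cK := @rV_compact R N (fun=> `[- M, M]%classic)
  (fun=> @segment_compact R (- M) M).
rewrite (_ : [set v | _] =
  trmx @` [set v : 'rV[R]_N | forall i, `[- M, M]%classic (v ord0 i)]).
  apply: continuous_compact => //; apply: continuous_subspaceT => v A.
  move=> /nbhs_ballP[e e0 eA]; apply/nbhs_ballP; exists e => // w [_ vw].
  by apply: eA; split => // i j; rewrite !mxE; exact: vw.
apply/seteqP; split => [v vM|_ [v vM <-] i].
  exists v^T; last by rewrite trmxK.
  by move=> i; rewrite /= in_itv/= mxE -ler_norml; exact: vM.
by rewrite mxE ler_norml; have := vM i; rewrite /= in_itv.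
Qed.

Lemma halfspace_convex (c : R) y : convex_set [set v : 'cV[R]_N | dot v y <= c].
Proof.
move=> u v t; rewrite !inE/= => uc vc.
rewrite [_ <| _ |> _]/(t%:num *: u + (1 - t%:num) *: v) dotDl !dotZl.
apply: (@le_trans _ _ (t%:num * c + (1 - t%:num) * c)).
  apply: lerD; apply: ler_wpM2l => //; last by rewrite subr_ge0 le1.
by rewrite -mulrDl [t%:num + _]addrC subrK mul1r.
Qed.

Lemma halfspace_closed (c : R) y : closed [set v : 'cV[R]_N | dot v y <= c].
Proof.
apply: (@closed_comp _ _ (fun v : 'cV[R]_N => dot v y) [set r | r <= c]).
  by move=> v _; exact: dot_continuous.
exact: closed_le.
Qed.

End euclidean_space.

Definition dot_linear {R : realType} {N : nat} := (@dotDl R N, @dotNl R N,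
  @dotZl R N, @dotDr R N, @dotNr R N, @dotZr R N).

(** * Filippov sets *)

Section filippov_map.
Context {R : realType} {n : nat}.
Local Notation vec := 'cV[R]_n.+1.
Local Notation negligible := (@lebesgue_measure R).-negligible.

(** Otherwise the set where [dot (g z) y] is too small is non-null in every ball
    around [y], and the essentially bounded values of [g] on it accumulate at
    some [eta], which then belongs to the Filippov set. *)
Lemma filippov_ess_lower_bound (g : vec -> vec) (y : vec) (c e : R) :
  locally_ess_bounded g -> (forall eta, filippov g y eta -> c <= dot eta y) ->
  0 < e ->
  exists r N0, [/\ 0 < r, lebesgue_null N0 &
    forall z, eball y r z -> ~ N0 z -> c - e <= dot (g z) y].
Proof.
move=> bg gc e0; apply: contrapT => none.
have [r0 [M [r00 [N1 null1 gM]]]] := bg y.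
pose G := [set A : set vec | exists r N0, [/\ 0 < r, lebesgue_null N0 &
  forall z, eball y r z -> ~ N0 z -> dot (g z) y < c - e -> A (g z)]].
have FG : ProperFilter G.
  apply: Build_ProperFilter_ex.
    move=> A [r [N0 [r_gt0 null0 GA]]]; apply: contrapT => A0.
    apply: none; exists r, N0; split => // z zr zN.
    rewrite leNgt; apply/negP => /(GA z zr zN) Ag.
    by apply: A0; exists (g z).
  split.
  - by exists 1, set0; split => //; exact: lebesgue_null0.
  - move=> A B [r [N0 [r_gt0 null0 GA]]] [s [N2 [s_gt0 null2 GB]]].
    exists (Num.min r s), (N0 `|` N2); split.
    + by rewrite lt_min r_gt0.
    + exact: lebesgue_nullU.
    + move=> z; rewrite /eball/= lt_min => /andP[zr zs] /not_orP[zN0 zN2] zc.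
      by split; [exact: GA | exact: GB].
  - move=> A B AB [r [N0 [r_gt0 null0 GA]]]; exists r, N0; split => // z zr zN zc.
    exact/AB/GA.
have GM : G [set v | forall i, `|v i 0| <= M].
  exists r0, N1; split => // z zr zN _ i.
  by apply: le_trans (coord_le_norm2 _ _) _; apply: gM.
have [eta [_ Geta]] := @compact_coord_bounded R n.+1 M G FG GM.
have closedG C : closed C -> G C -> C eta.
  move=> cC GC; rewrite ((closure_id C).1 cC) => B nB.
  by rewrite setIC; have := Geta C B GC nB; rewrite setIC.
have etac : dot eta y <= c - e.
  apply: (closedG [set v : vec | dot v y <= c - e]) => //.
    exact: halfspace_closed.
  exists 1, set0; split => //; first exact: lebesgue_null0.
  by move=> z _ _ /ltW.
have : c <= dot eta y.
  apply: gc => r /= r_gt0 N0 null0 C [cC _ CS]; apply: closedG => //.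
  by exists r, N0; split => // z zr zN _; apply: CS; exists z.
by lra.
Qed.

(** [m] lies within [e] below the essential infimum of [h] near [y], which is
    the supremum of the levels under which [h] drops only on a null set; level
    [0] is one of them because [h] is nonnegative. *)
Lemma nonneg_ess_inf (h : R -> R) (y delta e : R) :
  0 < delta -> 0 < e -> (forall s, `|s - y| < delta -> 0 <= h s) ->
  exists m, negligible [set s | `|s - y| < delta /\ h s < m] /\
    ~ negligible [set s | `|s - y| < delta /\ h s < m + e].
Proof.
move=> delta0 e0 h0; pose S m := [set s | `|s - y| < delta /\ h s < m].
have S_nondec m m' : m <= m' -> S m `<=` S m'.
  by move=> mm' s [sy sm]; split => //; exact: lt_le_trans mm'.
have [m Sm] : exists m, ~ negligible (S m).
  apply: contrapT => /forallNP nullS.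
  have : negligible (ball y delta).
    suff : negligible (\bigcup_k S k%:R).
      apply: negligibleS => s; rewrite /ball/= distrC => sy; exists (Num.truncn (h s)).+1 => //.
      by split => //; exact: truncnS_gt.
    by apply: negligible_bigcup => k; apply: contrapT => /nullS.
  move/measure_negligible => /(_ (measurable_ball _ _)).
  rewrite [X in X = _ -> _]lebesgue_measure_ball ?ltW// => /eqP.
  by rewrite eqe mulrn_eq0 /= gt_eqF.
pose A := [set m | negligible (S m)].
have A0 : A 0.
  rewrite /A/= (_ : S 0 = set0); first exact: negligible_set0.
  by apply/seteqP; split => // s [/h0]; rewrite leNgt => /negP.
have ubA : ubound A m.
  move=> m' Am'; rewrite leNgt; apply/negP => /ltW /S_nondec mm'.
  by apply: Sm; move: Am'; apply: negligibleS.
have supA : has_sup A by split; [exists 0 | exists m].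
have [m' Am' m's] := sup_adherent e0 supA.
exists m'; split => // /(sup_upper_bound supA).
by rewrite leNgt => /negP; apply; lra.
Qed.

(** A sum of functions of separate variables is essentially bounded below only
    if the essential infima of its terms add up to the bound, because the
    points where all terms are close to their infima form a non-null set. *)
Lemma separable_ess_lower_bound (h : 'I_n.+1 -> R -> R) (y : vec)
    (delta c e : R) (N0 : set vec) :
  0 < delta -> lebesgue_null N0 ->
  (forall i s, `|s - y i 0| < delta -> 0 <= h i s) ->
  (forall w : vec, (forall i, `|w i 0 - y i 0| < delta) -> ~ N0 w ->
    c <= \sum_i h i (w i 0)) ->
  0 < e ->
  exists m : 'I_n.+1 -> R,
    (forall i, negligible [set s | `|s - y i 0| < delta /\ h i s < m i]) /\
    c - e <= \sum_i m i.
Proof.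
move=> delta0 null0 h0 hc e0; pose e' := e / n.+1%:R.
have e'0 : 0 < e' by rewrite divr_gt0.
have /choice[m mP] : forall i, exists m,
    negligible [set s | `|s - y i 0| < delta /\ h i s < m] /\
    ~ negligible [set s | `|s - y i 0| < delta /\ h i s < m + e'].
  by move=> i; apply: nonneg_ess_inf => // s; exact: h0.
exists m; split => [i|]; first by have [] := mP i.
have := @lebesgue_nonnull_product R n _ (fun i => (mP i).2).
set P := [set z | _] => nullP.
have [w [Pw wN]] : exists w, P w /\ ~ N0 w.
  apply: contrapT => none; apply: nullP; apply: lebesgue_nullS null0.
  by move=> w Pw; apply: contrapT => wN; apply: none; exists w.
have := hc w (fun i => (Pw i).1) wN.
have : \sum_i h i (w i 0) <= \sum_i (m i + e').
  by apply: ler_sum => i _; apply: ltW; have [] := Pw i.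
rewrite big_split/= sumr_const card_ord -[e' *+ _]mulr_natr divfK ?pnatr_eq0//.
by lra.
Qed.

(** Makes the terms [y_i g_i] nonnegative near [y] for a sign-preserving [g]. *)
Lemma locally_sign_constant (y : vec) : exists2 delta, 0 < delta &
  forall i s, `|s - y i 0| < delta -> y i 0 != 0 -> Num.sg s = Num.sg (y i 0).
Proof.
pose d i := if y i 0 == 0 then 1 else `|y i 0|.
have d0 i : 0 < d i by rewrite /d; case: eqVneq => // yi; rewrite normr_gt0.
exists (\big[Num.min/1]_i d i).
  by elim/big_ind: _ => // a b a0 b0; rewrite lt_min a0.
move=> i s sy yi; have {sy} : `|s - y i 0| < `|y i 0|.
  apply: (lt_le_trans sy); have -> : `|y i 0| = d i by rewrite /d (negbTE yi).
  exact: bigmin_le_cond.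
have [y0|y0|y0] := ltgtP (y i 0) 0; last by rewrite y0 eqxx in yi.
  rewrite (ltr0_norm y0) ltr_norml => /andP[_ sy].
  by rewrite !ltr0_sg//; lra.
rewrite (gtr0_norm y0) ltr_norml => /andP[sy _].
by rewrite !gtr0_sg//; lra.
Qed.

(** The image of [L] is a null set, so the almost everywhere bound on [g] near
    [L *m x] says nothing a priori about [g] on that image. Since [g] acts
    componentwise, the bound splits into bounds on the line, and these can be
    pulled back along the nonzero rows of [L]. *)
Lemma filippov_comp_mulmx (L : 'M[R]_n.+1) (g : vec -> vec) (x : vec) (c : R) :
  componentwise_sign_preserving g ->
  (forall i, exists j, L i j != 0) ->
  (forall e, 0 < e -> exists r N0, [/\ 0 < r, lebesgue_null N0 &
     forall z, eball (L *m x) r z -> ~ N0 z -> c - e <= dot (g z) (L *m x)]) ->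
  forall eta, filippov (fun z => - g (L *m z)) x eta ->
    dot eta (L *m x) <= - c.
Proof.
move=> [sg_g [gi gE]] L0 gc eta Feta; set y := L *m x in gc *.
apply/ler_addgt0Pr => e e0.
have [|r [N0 [r0 null0 gr]]] := gc (e / 2); first by lra.
have [delta1 delta10 sg_y] := locally_sign_constant y.
pose delta := Num.min delta1 (r / n.+1%:R).
have delta0 : 0 < delta by rewrite lt_min delta10 divr_gt0.
pose h i s := y i 0 * gi i s.
have sg_gi i s : Num.sg (gi i s) = Num.sg s.
  by have := sg_g (const_mx s) i; rewrite gE mxE.
have h0 i s : `|s - y i 0| < delta -> 0 <= h i s.
  rewrite lt_min => /andP[sy _]; rewrite /h.
  have [->|yi] := eqVneq (y i 0) 0; first by rewrite mul0r.
  by rewrite -sgr_ge0 sgrM sg_gi (sg_y i s)// -expr2 sqr_ge0.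
have dot_gE w : dot (g w) y = \sum_i h i (w i 0).
  by rewrite dotE; apply: eq_bigr => i _; rewrite gE mulrC.
have near_y (w : vec) : (forall i, `|w i 0 - y i 0| < delta) -> eball y r w.
  move=> wy; rewrite /eball/=; apply: (le_lt_trans (norm2_le_sum _)).
  have -> : r = \sum_(i < n.+1) (r / n.+1%:R).
    by rewrite sumr_const card_ord -[RHS]mulr_natr divfK ?pnatr_eq0.
  apply: ltr_sum; first by apply/hasP; exists ord0 => //; exact: mem_index_enum.
  by move=> i _; rewrite mxE [X in _ + X]mxE; have := wy i; rewrite lt_min => /andP[].
have [w wy wN||m [nullm mc]] := @separable_ess_lower_bound h y delta (c - e / 2)
    (e / 2) N0 delta0 null0 h0.
- by rewrite -dot_gE; apply: gr => //; exact: near_y.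
- by lra.
- pose N' := \bigcup_i [set z : vec | `|(L *m z) i 0 - y i 0| < delta /\
    h i ((L *m z) i 0) < m i].
  have null' : lebesgue_null N'.
    apply: lebesgue_null_bigcup_fin => i; have [j Lij] := L0 i.
    apply: (lebesgue_nullS _ (lebesgue_null_linear_preimage Lij (nullm i))).
    by move=> z /=; rewrite !mxE.
  pose K := \sum_i \sum_j `|L i j|.
  have K0 : 0 <= K by apply: sumr_ge0 => i _; exact: sumr_ge0.
  have d0 : 0 < delta / (K + 1) by rewrite divr_gt0//; lra.
  apply: (Feta _ d0 _ null' [set v : vec | dot v y <= - c + e]).
  split; [exact: halfspace_closed | exact: halfspace_convex |].
  move=> _ [z [zx zN] <-] /=; rewrite dotNl dot_gE.
  suff : \sum_i m i <= \sum_i h i ((L *m z) i 0) by lra.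
  apply: ler_sum => i _; rewrite leNgt; apply/negP => him; apply: zN.
  exists i => //; split => //.
  have -> : (L *m z) i 0 - y i 0 = \sum_j L i j * (z - x) j 0.
    transitivity ((L *m (z - x)) i 0); last by rewrite mxE.
    by rewrite mulmxBr [RHS]mxE [X in _ = _ + X]mxE.
  apply: (@le_lt_trans _ _ (K * norm2 (z - x))).
    apply: (le_trans (ler_norm_sum _ _ _)).
    apply: (@le_trans _ _ ((\sum_j `|L i j|) * norm2 (z - x))).
      rewrite mulr_suml; apply: ler_sum => j _.
      by rewrite normrM ler_wpM2l// coord_le_norm2.
    rewrite ler_wpM2r ?norm2_ge0// /K [leRHS](bigD1 i)//= lerDl.
    by apply: sumr_ge0 => k _; exact: sumr_ge0.
  apply: (@le_lt_trans _ _ ((K + 1) * norm2 (z - x))).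
    by rewrite ler_wpM2r ?norm2_ge0//; lra.
  by rewrite mulrC -ltr_pdivlMr//; lra.
Qed.

End filippov_map.

(** * Absolutely continuous functions *)

Section absolute_continuity.
Context {R : realType} {N : nat}.
Local Notation vec := 'cV[R]_N.

(** Compactness of a segment, in the form of an induction along the line. *)
Lemma segment_induction (c d : R) (P : R -> Prop) : c <= d -> P c ->
  (forall t, c <= t <= d -> exists2 r, 0 < r & forall s s',
     c <= s -> s <= t -> t <= s' -> s' <= d -> t - r < s -> s' < t + r ->
     P s -> P s') ->
  P d.
Proof.
move=> cd Pc step; pose A := [set s | c <= s <= d /\ P s].
have Ac : A c by split => //; rewrite lexx.
have ubA : ubound A d by move=> s [/andP[_ ->]].
have supA : has_sup A by split; [exists c | exists d].
have ct : c <= sup A by apply: sup_upper_bound.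
have td : sup A <= d by apply: ge_sup => //; exists c.
have [|r r0 stepr] := step (sup A); first by rewrite ct td.
have [s [/andP[cs sd] Ps] rs] := sup_adherent r0 supA.
have st : s <= sup A by apply: sup_upper_bound => //; split => //; rewrite cs.
have [dr|dr] := ltP d (sup A + r); first exact: (stepr s d).
pose s' := sup A + r / 2.
have s's : A s'.
  by split; [rewrite /s'; lra | apply: (stepr s) => //; rewrite /s'; lra].
have : s' <= sup A by apply: sup_upper_bound.
by rewrite /s'; lra.
Qed.

Lemma derive_near_le (f : R -> R) (t k e : R) :
  derivable f t 1 -> 'D_1 f t <= k -> 0 < e ->
  exists2 r, 0 < r & forall s s', s <= t -> t <= s' -> t - r < s ->
    s' < t + r -> f s' - f s <= (k + e) * (s' - s).
Proof.
move=> /cvgrPdist_lt/[swap] dk /[swap] e0 /(_ _ e0)[r /= r0 fr].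
have slope h : h != 0 -> `|h| < r -> h^-1 * (f (h + t) - f t) <= k + e.
  move=> h0 hr; have := fr h; rewrite /= sub0r normrN => /(_ hr h0).
  rewrite -[X in `|X - _|]/('D_1 f t) -[h *: 1]/(h * 1) mulr1.
  by rewrite -[_ *: _]/(_ * _) ltr_norml; lra.
exists r => // s s' st ts' rs s'r.
have right : f s' - f t <= (k + e) * (s' - t).
  have [->|ts] := eqVneq s' t; first by rewrite !subrr mulr0.
  have h0 : 0 < s' - t by rewrite subr_gt0 lt_neqAle eq_sym ts.
  have := @slope (s' - t); rewrite subrK gt_eqF// gtr0_norm// => /(_ isT).
  by rewrite ler_pdivrMl// mulrC => H; apply: H; lra.
have left : f t - f s <= (k + e) * (t - s).
  have [->|ts] := eqVneq s t; first by rewrite !subrr mulr0.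
  have h0 : 0 < t - s by rewrite subr_gt0 lt_neqAle ts.
  have : (s - t)^-1 * (f s - f t) <= k + e.
    have := @slope (s - t); rewrite subrK; apply; first by rewrite subr_eq0.
    by rewrite distrC gtr0_norm//; lra.
  rewrite (_ : f t - f s = (s - t)^-1 * (f s - f t) * (t - s)).
    by apply: ler_wpM2r; exact: ltW.
  by field; rewrite subr_eq0.
by lra.
Qed.

Lemma sum_disjoint_itv_le (n : nat) (a b : 'I_n -> R) (U : set R) :
  (forall k, a k <= b k) -> trivIset setT (fun k => `]a k, b k[%classic) ->
  (forall k, `]a k, b k[%classic `<=` U) -> open U ->
  ((\sum_k (b k - a k))%:E <= lebesgue_measure U)%E.
Proof.
move=> ab disj sub oU.
have mitv (k : 'I_n) : measurable (`]a k, b k[%classic : set R) by [].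
apply: (@le_trans _ _
  (lebesgue_measure (\big[setU/set0]_(k < n) (`]a k, b k[%classic : set R)))).
  rewrite measure_bigsetU_ord// -sumEFin; apply: lee_sum => k _.
  rewrite [leRHS]lebesgue_measure_itv/= lte_fin.
  by case: ifPn => //; rewrite -leNgt => ba; rewrite lee_fin subr_le0.
apply: le_measure; rewrite ?inE.
- exact: bigsetU_measurable.
- exact: open_measurable.
- by elim/big_ind: _ => [//|A B AU BU s [/AU|/BU]//|k _]; exact: sub.
Qed.

(** The exceptional times lie in an open set [U] so small that, by absolute
    continuity, the growth over disjoint intervals inside [U] is negligible. At
    the other times the derivative controls the growth over a neighbourhood, and
    [segment_induction] combines the two kinds of steps. *)
Lemma absolutely_continuous_growth (x : R -> vec) (F : R -> R) (c d K k : R) :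
  c <= d -> abs_continuous_on x c d -> 0 < K ->
  (forall s t, c <= s <= d -> c <= t <= d ->
    `|F s - F t| <= K * norm2 (x s - x t)) ->
  {ae lebesgue_measure, forall t, c <= t <= d ->
    derivable F t 1 /\ 'D_1 F t <= k} ->
  F d - F c <= k * (d - c).
Proof.
move=> cd acx K0 lipF aeF.
apply/ler_addgt0Pr => e' e'0.
pose e := e' / (d - c + 1).
have e0 : 0 < e by rewrite divr_gt0//; lra.
suff : F d - F c <= (k + e) * (d - c) + e.
  rewrite (_ : _ + e = k * (d - c) + e') // /e; field.
  by rewrite gt_eqF//; lra.
have [delta delta0 acd] := acx (e / 2 / K) (divr_gt0 (divr_gt0 e0 (ltr0Sn _ 1)) K0).
pose E := ~` [set t | c <= t <= d -> derivable F t 1 /\ 'D_1 F t <= k].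
have E0 : mu_ext (@wlength R idfun) E = 0%E by exact/negligible_outer_measure.
pose eta := Num.min (delta / 2) (e / 2 / (`|k| + 1)).
have k1 : 0 < `|k| + 1 by rewrite ltr_wpDl.
have eta0 : 0 < eta by rewrite lt_min; apply/andP; split; rewrite divr_gt0//; lra.
have [U [oU EU]] := outer_measure_open_le E eta0; rewrite E0 add0e => mU.
(* Up to time [s], the growth exceeds the rate [k + e] only by the increments
   over finitely many disjoint intervals inside [U]. For negative [k] these
   intervals also lose [|k|] times their length. *)
pose P s := exists (n : nat) (a b : 'I_n -> R), [/\
  forall j, c <= a j <= b j /\ b j <= s,
  forall j, `]a j, b j[%classic `<=` U,
  trivIset setT (fun j => `]a j, b j[%classic) &
  F s - F c <= (k + e) * (s - c) +
      \sum_j (K * norm2 (x (b j) - x (a j)) + `|k| * (b j - a j))].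
have [|t ctd|n [a [b [abd abU disj Fd]]]] :=
    @segment_induction c d P cd.
- exists 0%N, (fun=> 0), (fun=> 0); split; try by case.
  by rewrite big_ord0 !subrr mulr0 addr0.
- have [Ut|nUt] := pselect (U t).
    have [r /= r0 rU] : \forall r \near 0^'+, ball t r `<=` U.
      exact: open_subball.
    exists (r / 2); first by lra.
    move=> s s' cs st ts' s'd rs s'r [n [a [b [abs abU disj Fs]]]].
    exists n.+1, (fun j => oapp a s (unlift ord_max j)),
      (fun j => oapp b s' (unlift ord_max j)); split.
    + move=> j; case: unliftP => [i _|_] /=.
        by have [] := abs i; split => //; lra.
      by split; lra.
    + move=> j; case: unliftP => [i _|_] /=; first exact: abU.
      move=> u /=; rewrite in_itv/= => su; apply: (rU (r / 2)) => /=.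
      * by rewrite sub0r normrN gtr0_norm; lra.
      * by lra.
      * by rewrite /ball/= ltr_distl; lra.
    + move=> i j _ _; case: unliftP => [i' ->|->]; case: unliftP => [j' ->|->] //=.
      * by move=> /disj ->.
      * move=> [u [/=]]; rewrite !in_itv/= => /andP[_ ub] /andP[su _].
        by exfalso; have [_] := abs i'; lra.
      * move=> [u [/=]]; rewrite !in_itv/= => /andP[su _] /andP[_ ub].
        by exfalso; have [_] := abs j'; lra.
    + rewrite (bigD1_ord ord_max)//= unlift_none/=.
      under eq_bigr do rewrite liftK/=.
      have cs'd : c <= s' <= d by apply/andP; split; lra.
      have csd : c <= s <= d by apply/andP; split; lra.
      have /andP[_ lip] : - (K * norm2 (x s' - x s)) <= F s' - F s <=
          K * norm2 (x s' - x s) by rewrite -ler_norml lipF.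
      have ks : - (`|k| * (s' - s)) <= (k + e) * (s' - s).
        rewrite -mulNr ler_wpM2r//; first by lra.
        by have := ler_norm (- k); rewrite normrN; lra.
      move: Fs; set Sum := \sum_j _ => Fs.
      by lra.
  have [/(_ ctd)[dF Fk]|] := pselect (c <= t <= d -> derivable F t 1 /\ 'D_1 F t <= k); last first.
    by move=> /EU.
  have [r r0 Fr] := derive_near_le dF Fk e0.
  exists r => // s s' cs st ts' s'd rs s'r [n [a [b [abs abU disj Fs]]]].
  exists n, a, b; split => //.
    by move=> j; have [? ?] := abs j; split => //; lra.
  by have := Fr _ _ st ts' rs s'r; lra.
apply: (le_trans Fd); rewrite lerD2l big_split/= -!mulr_sumr.
have ab j : a j <= b j by have [/andP[]] := abd j.
have := sum_disjoint_itv_le ab disj abU oU.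
move=> /le_trans/(_ mU); rewrite lee_fin le_min => /andP[len1 len2].
have : `|k| * \sum_j (b j - a j) <= e / 2.
  rewrite ler_pdivlMr// in len2; apply: le_trans len2; rewrite mulrC.
  by rewrite ler_wpM2l ?lerDl// sumr_ge0// => j _; rewrite subr_ge0.
have : K * \sum_j norm2 (x (b j) - x (a j)) < e / 2.
  by rewrite mulrC -ltr_pdivlMr//; apply: acd => //; lra.
by lra.
Qed.

End absolute_continuity.

(** * Spectral gap of symmetric matrices and Laplacians *)

Section symmetric_matrices.
Context {R : realType} {n : nat}.
Local Notation vec := 'cV[R]_n.
Implicit Types (P L : 'M[R]_n) (u v : vec).

Lemma dot_sym L u v : L^T = L -> dot u (L *m v) = dot (L *m u) v.
Proof. by move=> LT; rewrite trmx_mul LT mulmxA. Qed.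

Lemma dot_gt0 v : v != 0 -> 0 < dot v v.
Proof.
move=> v0; rewrite lt_neqAle dot_ge0 andbT eq_sym.
by apply: contra v0 => /eqP /dot_eq0 ->.
Qed.

(** A zero of a nonnegative quadratic form is a minimizer; this is the
    first-order condition there, tested in the direction [- P v]. *)
Lemma psd_kernel P v : P^T = P -> (forall u, 0 <= dot u (P *m u)) ->
  dot v (P *m v) = 0 -> P *m v = 0.
Proof.
move=> PT psd Pv0; apply: contrapT => /eqP /dot_gt0.
set w := P *m v; set a := dot w w => a0; pose b := dot w (P *m w).
have b0 : 0 <= b by exact: psd.
pose s := a / (b + 1); have := psd (v - s *: w).
have -> : dot (v - s *: w) (P *m (v - s *: w)) = s * (s * b - 2 * a).
  rewrite mulmxBr -scalemxAr !dot_linear.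
  by rewrite Pv0 dot_sym// -/w -/a -/b; ring.
have s0 : 0 < s by rewrite divr_gt0//; lra.
rewrite pmulr_rge0// /s mulrAC subr_ge0 => h.
have : a * b / (b + 1) <= a by rewrite ler_pdivrMr; nra.
by lra.
Qed.

Lemma eigenvalue_sym L (mu : R) v : L^T = L -> v != 0 -> L *m v = mu *: v ->
  eigenvalue L mu.
Proof.
move=> LT v0 Lv; apply/eigenvalueP; exists v^T; last by rewrite trmx_eq0.
by rewrite -[in LHS]LT -trmx_mul Lv linearZ.
Qed.

(** The Rayleigh quotient attains its minimum on the unit sphere, and by
    [psd_kernel] the minimizer is an eigenvector. *)
Lemma quadratic_form_min P v0 : P^T = P -> v0 != 0 ->
  exists v m, [/\ v != 0, P *m v = m *: v &
    forall u, m * dot u u <= dot u (P *m u)].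
Proof.
move=> PT v00; pose S := [set v : vec | dot v v = 1].
have normalize u : u != 0 -> S ((norm2 u)^-1 *: u).
  move=> u0; have d0 := dot_gt0 u0.
  have nu : norm2 u != 0.
    by apply/eqP => nu; move: d0; rewrite -norm2_sqr nu expr0n ltxx.
  by rewrite /S/= dotZl dotZr -norm2_sqr; field.
have cS : compact S.
  apply: (@subclosed_compact _ _ [set v : vec | forall i, `|v i 0| <= 1]).
  - apply: (@closed_comp _ _ (fun v : vec => dot v v) [set 1]).
      move=> v _; have := @dot_diag_continuous R n 1%:M v.
      by under eq_fun do rewrite mul1mx.
    exact: closed_eq.
  - exact: compact_coord_bounded.
  - move=> v Sv i; apply: (le_trans (coord_le_norm2 _ _)).
    by rewrite -(ler_pXn2r (ltn0Sn 1)) ?nnegrE ?norm2_ge0// norm2_sqr Sv expr1n.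
have [||v] := @compact_EVT_min _ R (fun v : vec => dot v (P *m v)) S _ cS.
- by exists ((norm2 v0)^-1 *: v0); exact: normalize.
- by apply: continuous_subspaceT => v; exact: dot_diag_continuous.
rewrite inE => Sv vmin; exists v, (dot v (P *m v)).
have v_neq0 : v != 0.
  by apply/eqP => v0'; move: Sv; rewrite /S/= v0' mulmx0 mxE => /eqP; rewrite eq_sym oner_eq0.
set m := dot v (P *m v).
have Pm u : m * dot u u <= dot u (P *m u).
  have [->|u0] := eqVneq u 0; first by rewrite !mulmx0 mxE mulr0.
  have := vmin _ (mem_set (normalize u u0)).
  rewrite -scalemxAr dotZl dotZr mulrA -expr2 exprVn norm2_sqr -/m.
  by rewrite ler_pdivlMl ?dot_gt0// mulrC.
split => //; apply/eqP; rewrite -subr_eq0 -mul_scalar_mx -mulmxBl; apply/eqP.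
have QE u : dot u ((P - m%:M) *m u) = dot u (P *m u) - m * dot u u.
  by rewrite mulmxBl mul_scalar_mx !dot_linear.
apply: psd_kernel.
- by rewrite linearB/= tr_scalar_mx PT.
- by move=> u; rewrite QE subr_ge0.
- by rewrite QE Sv mulr1 subrr.
Qed.

(** Otherwise the form [|L v|^2 - lambda (v, L v)] has a negative minimum on the
    sphere, hence [L^2 - lambda L] has a negative eigenvalue [m], and the roots
    of [X^2 - lambda X - m] produce an eigenvalue of [L] strictly between [0]
    and [lambda]. *)
Lemma spectral_gap L (lambda : R) v : L^T = L -> 0 < lambda ->
  (forall mu, eigenvalue L mu -> mu != 0 -> lambda <= mu) ->
  lambda * dot v (L *m v) <= dot (L *m v) (L *m v).
Proof.
move=> LT lambda0 gap; rewrite leNgt; apply/negP => vlt.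
pose P := L *m L - lambda *: L.
have PE u : dot u (P *m u) = dot (L *m u) (L *m u) - lambda * dot u (L *m u).
  by rewrite mulmxBl -scalemxAl !dot_linear -mulmxA (dot_sym u (L *m u) LT).
have v0 : v != 0.
  by apply/eqP => v0; move: vlt; rewrite v0 !mulmx0 mxE mulr0 ltxx.
have PT : P^T = P by rewrite linearB linearZ/= trmx_mul LT.
have [w [m [w0 Pw mmin]]] := quadratic_form_min PT v0.
have m0 : m < 0.
  rewrite -(pmulr_llt0 _ (dot_gt0 v0)); apply: (le_lt_trans (mmin v)).
  by rewrite PE subr_lt0.
have LLw : L *m (L *m w) = lambda *: (L *m w) + m *: w.
  by rewrite -Pw /P mulmxBl -scalemxAl mulmxA addrC subrK.
(* The discriminant of [X^2 - lambda X - m] is nonnegative because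
   [|(L - lambda / 2) w|^2 = D / 4 |w|^2]. *)
pose D := lambda ^+ 2 + 4 * m.
have D0 : 0 <= D.
  have := dot_ge0 (L *m w - (lambda / 2) *: w).
  rewrite !dot_linear.
  rewrite -(dot_sym w (L *m w) LT) LLw !dot_linear (dotC (L *m w) w).
  set q := dot w (L *m w); rewrite (_ : _ + _ = D / 4 * dot w w).
    by rewrite pmulr_lge0 ?dot_gt0//; lra.
  by rewrite /D; field.
pose r := Num.sqrt D; have r0 : 0 <= r by exact: sqrtr_ge0.
have rD : r ^+ 2 = lambda ^+ 2 + 4 * m by rewrite sqr_sqrtr.
have rl : r < lambda by rewrite -(ltr_pXn2r (ltn0Sn 1)) ?nnegrE ?(ltW lambda0)// rD; lra.
have noev mu : 0 < mu -> mu < lambda -> ~~ eigenvalue L mu.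
  move=> mu0 mul; apply/negP => /gap /(_ (lt0r_neq0 mu0)).
  by rewrite leNgt mul.
pose a := (lambda + r) / 2; pose b := (lambda - r) / 2.
have [w'0|w'0] := eqVneq (L *m w - a *: w) 0.
  have /negP := noev a ltac:(rewrite /a; lra) ltac:(rewrite /a; lra); apply.
  by apply: (eigenvalue_sym LT w0); apply/eqP; rewrite -subr_eq0 w'0.
have /negP := noev b ltac:(rewrite /b; lra) ltac:(rewrite /b; lra); apply.
apply: (eigenvalue_sym LT w'0).
rewrite mulmxBr LLw -scalemxAr scalerBr scalerA.
have -> : b * a = - m.
  have mE : m = (r ^+ 2 - lambda ^+ 2) / 4 by rewrite rD; field.
  by rewrite /a /b mE; field.
have abE : lambda = b + a by rewrite /a /b; field.
by rewrite [in LHS]abE scalerDl scaleNr opprK addrAC addrK.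
Qed.

End symmetric_matrices.

Section laplacian.
Context {R : realType} {n : nat}.
Variable A : 'M[R]_n.+1.
Hypothesis graphA : undirected_graph A.
Local Notation L := (laplacian A).

Lemma laplacian_sym : L^T = L.
Proof.
have [AT _ _] := graphA.
by rewrite /laplacian linearB/= tr_diag_mx AT.
Qed.

Lemma laplacian_mulmxE (v : 'cV[R]_n.+1) i :
  (L *m v) i 0 = \sum_j A i j * (v i 0 - v j 0).
Proof.
rewrite /laplacian mulmxBl mul_diag_mx !mxE mulr_suml -sumrB.
by apply: eq_bigr => j _; rewrite mulrBr.
Qed.

Lemma laplacian_form (v : 'cV[R]_n.+1) :
  2 * dot v (L *m v) = \sum_i \sum_j A i j * (v i 0 - v j 0) ^+ 2.
Proof.
have [AT _ _] := graphA.
have Asym i j : A j i = A i j by rewrite -[in LHS]AT mxE.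
have E : dot v (L *m v) = \sum_i \sum_j A i j * v i 0 * (v i 0 - v j 0).
  rewrite dotE; apply: eq_bigr => i _; rewrite laplacian_mulmxE mulr_sumr.
  by apply: eq_bigr => j _; ring.
have E' : dot v (L *m v) = \sum_i \sum_j A i j * v j 0 * (v j 0 - v i 0).
  rewrite E exchange_big/=; apply: eq_bigr => i _; apply: eq_bigr => j _.
  by rewrite Asym.
rewrite mulr_natl mulr2n [X in X + _]E E' -big_split/=; apply: eq_bigr => i _.
by rewrite -big_split/=; apply: eq_bigr => j _; ring.
Qed.

Lemma laplacian_psd (v : 'cV[R]_n.+1) : 0 <= dot v (L *m v).
Proof.
have [_ A0 _] := graphA.
rewrite -(pmulr_rge0 _ (ltr0Sn R 1)) laplacian_form.
by apply: sumr_ge0 => i _; apply: sumr_ge0 => j _; rewrite mulr_ge0 ?sqr_ge0.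
Qed.

Lemma laplacian_form_eq0 (v : 'cV[R]_n.+1) : connected_graph A ->
  dot v (L *m v) = 0 -> consensus v.
Proof.
move=> conn v0; have [_ A0 _] := graphA.
have edge i j : 0 < A i j -> v i 0 = v j 0.
  move=> Aij; have := laplacian_form v; rewrite v0 mulr0 => /esym/eqP.
  have term_ge0 k l : 0 <= A k l * (v k 0 - v l 0) ^+ 2.
    by rewrite mulr_ge0 ?sqr_ge0.
  rewrite psumr_eq0 => [|k _]; last by exact: sumr_ge0.
  move=> /allP/(_ i (mem_index_enum i)); rewrite psumr_eq0//=.
  move=> /allP/(_ j (mem_index_enum j)).
  by rewrite /= mulf_eq0 gt_eqF//= sqrf_eq0 subr_eq0 => /eqP.
exists (v ord0 0); apply/colP => i; rewrite !mxE mulr1.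
have /connectP[p] := conn ord0 i; elim: p ord0 => [j _ ->//|k p IH j] /= /andP[jk kp].
by move=> ip; rewrite (edge _ _ jk); exact: IH.
Qed.

(** If row [i] vanishes, the [i]-th unit vector has energy zero and is a
    consensus state, so [i] is the only agent and [L] is zero. *)
Lemma laplacian_row_neq0 (i : 'I_n.+1) : connected_graph A -> L != 0 ->
  exists j, L i j != 0.
Proof.
move=> conn L0; apply: contrapT => /forallNP row0.
have Li j : L i j = 0 by apply/eqP; apply: contrapT => /negP /row0.
have Lji j : L j i = 0 by rewrite -[in LHS]laplacian_sym mxE.
pose d : 'cV[R]_n.+1 := delta_mx i 0.
have Ld : L *m d = 0 by rewrite /d -colE; apply/colP => j; rewrite [LHS]mxE Lji mxE.
have [c dc] : consensus d by apply: laplacian_form_eq0; rewrite ?Ld ?mulmx0 ?mxE.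
have d_all k : k = i.
  apply/eqP; apply: contrapT => /negP ki.
  have := congr1 (fun v : 'cV[R]_n.+1 => v k 0) dc.
  have := congr1 (fun v : 'cV[R]_n.+1 => v i 0) dc.
  by rewrite !mxE !eqxx (negbTE ki) /= mulr1 => <- /eqP; rewrite eq_sym oner_eq0.
by move/eqP: L0; apply; apply/matrixP => k l; rewrite (d_all k) Li mxE.
Qed.

End laplacian.

(** * Energy along solutions *)

Section power_decay.
Context {R : realType}.

Lemma powR_le_endpoints (a m M u : R) : 0 < m -> m <= u <= M ->
  u `^ a <= m `^ a + M `^ a.
Proof.
move=> m0 /andP[mu uM]; have u0 : 0 < u by exact: lt_le_trans mu.
have M0 : 0 < M by exact: lt_le_trans uM.
have [a0|a0] := leP 0 a.
  apply: (@le_trans _ _ (M `^ a)); last by rewrite lerDr powR_ge0.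
  by apply: ge0_ler_powR => //; rewrite nnegrE ltW.
apply: (@le_trans _ _ (m `^ a)); last by rewrite lerDl powR_ge0.
rewrite -(opprK a) !(powRN _ (- a)) lef_pV2 ?posrE ?powR_gt0//.
by apply: ge0_ler_powR => //; rewrite ?nnegrE ?oppr_ge0 ltW.
Qed.

Lemma powR_lipschitz (a m M : R) : 0 < m -> exists2 K, 0 < K &
  forall u v, m <= u <= M -> m <= v <= M -> `|u `^ a - v `^ a| <= K * `|u - v|.
Proof.
move=> m0; pose K := `|a| * (m `^ (a - 1) + M `^ (a - 1)) + 1.
have K0 : 0 < K by rewrite ltr_wpDl// mulr_ge0// addr_ge0// powR_ge0.
exists K => // u v; wlog uv : u v / u <= v => [hw|] muM mvM.
  have [uv|/ltW vu] := leP u v; first exact: hw.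
  by rewrite distrC [`|u - v|]distrC; exact: hw.
have u0 : 0 < u by case/andP: muM => mu _; exact: lt_le_trans mu.
have [x||c] := @MVT_segment R (@powR R ^~ a) (fun c => a * c `^ (a - 1)) u v uv.
- rewrite in_itv/= => /andP[ux _]; apply: is_derive1_powR.
  exact: (@lt_trans _ _ u).
- apply: derivable_within_continuous => x; rewrite in_itv/= => /andP[ux _].
  by apply: derivable_powR; rewrite in_itv/= andbT (lt_le_trans u0).
rewrite in_itv/= => /andP[uc cv] E.
rewrite distrC [`|u - v|]distrC E normrM ler_wpM2r// normrM.
rewrite (ger0_norm (powR_ge0 _ _)) (@le_trans _ _
  (`|a| * (m `^ (a - 1) + M `^ (a - 1))))//; last by rewrite /K lerDl.
rewrite ler_wpM2l// powR_le_endpoints//.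
by move: muM mvM => /andP[mu _] /andP[_ vM]; rewrite (le_trans mu)//= (le_trans cv).
Qed.

(** The derivative of [e^a / a] is [e^(a-1) e'], which the inequality for [e']
    bounds by [- k]. The bounds [m] and [M] confine [e] to a segment on which
    the power is Lipschitz, so that [e^a / a] inherits absolute continuity. *)
Lemma power_decay {N : nat} (x : R -> 'cV[R]_N) (e : R -> R)
    (c d K m M a k : R) :
  c <= d -> abs_continuous_on x c d -> 0 < K ->
  (forall s t, c <= s <= d -> c <= t <= d ->
    `|e s - e t| <= K * norm2 (x s - x t)) ->
  0 < m -> (forall s, c <= s <= d -> m <= e s <= M) -> a != 0 ->
  {ae lebesgue_measure, forall t, c <= t <= d ->
    derivable e t 1 /\ 'D_1 e t <= - (k * e t `^ (1 - a))} ->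
  e d `^ a / a - e c `^ a / a <= - k * (d - c).
Proof.
move=> cd acx K0 lipe m0 emM a0 aee.
have [K' K'0 lipa] := @powR_lipschitz a m M m0.
pose F t := e t `^ a / a.
have -> : e d `^ a / a - e c `^ a / a = F d - F c by [].
apply: (@absolutely_continuous_growth R N x F c d (K' / `|a| * K)) => //.
- by rewrite mulr_gt0// divr_gt0// normr_gt0.
- move=> s t csd ctd; rewrite /F -mulrBl normrM normfV mulrC.
  rewrite [K' / _]mulrC -!mulrA ler_wpM2l ?invr_ge0//.
  apply: (le_trans (lipa _ _ (emM _ csd) (emM _ ctd))).
  by rewrite ler_wpM2l ?(ltW K'0)// lipe.
- move: aee; apply: negligibleS; apply: subsetC => t /= + ctd.
  move=> /(_ ctd)[de ek].
  have et : 0 < e t by apply: lt_le_trans m0 _; case/andP: (emM _ ctd).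
  have dF : is_derive t 1 F (a^-1 *: (a * e t `^ (a - 1) * 'D_1 e t)).
    rewrite (_ : F = a^-1 \*: ((@powR R ^~ a) \o e)); last first.
      by apply/funext => s; rewrite /F /= mulrC.
    apply: is_deriveZ; apply: is_derive1_comp; last exact: derivableP.
    exact: is_derive1_powR.
  split; first exact: ex_derive.
  have -> : 'D_1 F t = e t `^ (a - 1) * 'D_1 e t.
    transitivity (a^-1 * (a * e t `^ (a - 1) * 'D_1 e t)).
      exact: (@derive_val _ _ _ _ _ _ _ dF).
    by rewrite -mulrA mulKf.
  apply: (@le_trans _ _ (e t `^ (a - 1) * - (k * e t `^ (1 - a)))).
    by rewrite ler_wpM2l// powR_ge0.
  rewrite mulrN mulrCA -powRD; last by rewrite (gt_eqF et) implybT.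
  by rewrite [X in e t `^ X](_ : _ = 0) ?powRr0 ?mulr1//; ring.
Qed.

End power_decay.

Section quadratic_energy.
Context {R : realType} {N : nat}.
Local Notation vec := 'cV[R]_N.
Variables (L : 'M[R]_N) (x : R -> vec).
Hypothesis LT : L^T = L.

Lemma abs_continuous_onS (c d c' d' : R) : c <= c' -> d' <= d ->
  abs_continuous_on x c d -> abs_continuous_on x c' d'.
Proof.
move=> cc' dd' ac e e0; have [delta delta0 acd] := ac e e0.
exists delta => // n a b abd; apply: acd => j; have [/andP[ca ab] bd] := abd j.
by rewrite ab (le_trans cc')// (le_trans bd).
Qed.

(** The increments of [x] are less than [1] over times shorter than some
    [delta], so a bound propagates along the interval in finitely many steps. *)
Lemma abs_continuous_bounded (c d : R) : c <= d -> abs_continuous_on x c d ->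
  exists2 B, 0 < B & forall t i, c <= t <= d -> `|x t i 0| <= B.
Proof.
move=> cd ac; pose P s := exists2 B, 0 < B &
  forall t i, c <= t <= s -> `|x t i 0| <= B.
suff : P d by [].
apply: (@segment_induction R c) => //.
  exists (\sum_i `|x c i 0| + 1); first by rewrite ltr_wpDl// sumr_ge0.
  move=> t i; rewrite -eq_le => /eqP <-.
  by rewrite (bigD1 i)//= -addrA lerDl addr_ge0// sumr_ge0.
have [delta delta0 acd] := ac 1 ltr01.
move=> t ctd; exists (delta / 2); first by lra.
move=> s s' cs st ts' s'd ds s'd' [B B0 xB]; exists (B + 1); first by lra.
move=> u i /andP[cu us']; have [us|su] := leP u s.
  by rewrite (le_trans (xB u i _)) ?cu//; lra.
have : norm2 (x u - x s) < 1.
  have := acd 1%N (fun=> s) (fun=> u); rewrite !big_ord1; apply.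
  - by move=> _; split; lra.
  - by move=> [[|//] ?] [[|//] ?] _ _ _; apply/val_inj.
  - by lra.
have := coord_le_norm2 (x u - x s) i; rewrite mxE [X in _ + X]mxE.
have := xB s i; rewrite cs lexx => /(_ isT).
by have := ler_normB (x u i 0 - x s i 0) (- x s i 0); rewrite opprK subrK normrN; lra.
Qed.

Lemma quadratic_form_lipschitz (c d : R) : c <= d -> abs_continuous_on x c d ->
  exists2 K, 0 < K & forall s t, c <= s <= d -> c <= t <= d ->
    `|dot (x s) (L *m x s) - dot (x t) (L *m x t)| <= K * norm2 (x s - x t).
Proof.
move=> cd ac; have [B B0 xB] := abs_continuous_bounded cd ac.
pose K := \sum_i \sum_j `|L i j| * (B + B) + 1.
have K0 : 0 < K.
  rewrite ltr_wpDl// sumr_ge0// => i _; rewrite sumr_ge0// => j _.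
  by rewrite mulr_ge0//; lra.
exists K => // s t csd ctd.
have -> : dot (x s) (L *m x s) - dot (x t) (L *m x t) =
    dot (x s - x t) (L *m (x s + x t)).
  have E : dot (x t) (L *m x s) = dot (x s) (L *m x t).
    by rewrite (dot_sym _ _ LT) dotC.
  by rewrite mulmxDr !dot_linear E; ring.
rewrite dotE; apply: (le_trans (ler_norm_sum _ _ _)).
apply: (@le_trans _ _ (\sum_i (\sum_j `|L i j| * (B + B)) * norm2 (x s - x t))).
  apply: ler_sum => i _; rewrite normrM mulrC ler_pM//; last exact: coord_le_norm2.
  rewrite mxE; apply: (le_trans (ler_norm_sum _ _ _)); apply: ler_sum => j _.
  rewrite normrM ler_wpM2l// mxE (le_trans (ler_normD _ _))//.
  by rewrite lerD// xB.
by rewrite -mulr_suml ler_wpM2r ?norm2_ge0// /K lerDl.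
Qed.

Lemma is_derive_quadratic_form (t : R) : derivable x t 1 ->
  is_derive t 1 (fun s => dot (x s) (L *m x s)) (2 * dot ('D_1 x t) (L *m x t)).
Proof.
move=> dx; pose X i s := x s i 0; pose dX i := 'D_1 (X i) t.
have dXP i : is_derive t 1 (X i) (dX i).
  by apply: derivableP; exact: (derivable_mxP x t 1).1.
have DxE : 'D_1 x t = \col_i dX i.
  by rewrite derive_mx//; apply/matrixP => i j; rewrite !mxE !ord1.
rewrite (_ : (fun s => _) = \sum_i (X i * \sum_j (L i j \*: X j))); last first.
  apply/funext => s; rewrite dotE fct_sumE; apply: eq_bigr => i _.
  rewrite /X [RHS]/(_ * _) [in LHS]mxE; congr (_ * _).
  by rewrite fct_sumE.
have -> : 2 * dot ('D_1 x t) (L *m x t) = \sum_i (X i t *: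
    (\sum_j L i j *: dX j) + (\sum_j (L i j \*: X j)) t *: dX i).
  have -> : 2 * dot ('D_1 x t) (L *m x t) =
      dot (x t) (L *m 'D_1 x t) + dot ('D_1 x t) (L *m x t).
    rewrite (dot_sym (x t) ('D_1 x t) LT) (dotC (L *m x t)).
    by rewrite mulr_natl mulr2n.
  rewrite big_split/= !dotE DxE; congr (_ + _); apply: eq_bigr => i _.
    by rewrite mxE; congr (_ * _); apply: eq_bigr => j _; rewrite mxE.
  by rewrite !mxE [LHS]mulrC fct_sumE.
by apply: is_derive_sum => i; apply: is_deriveM.
Qed.

End quadratic_energy.

(** * Fixed-time consensus *)

Section fixed_time.
Context {R : realType} {N : nat}.
Variables (x : R -> 'cV[R]_N) (e : R -> R) (ks kr p q : R).
Hypotheses (ks0 : 0 < ks) (kr0 : 0 < kr) (p1 : p < 1) (q1 : 1 < q).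
Hypothesis ac_x : forall d, 0 <= d -> abs_continuous_on x 0 d.
Hypothesis lip_e : forall d, 0 <= d -> exists2 K, 0 < K &
  forall s t, 0 <= s <= d -> 0 <= t <= d ->
    `|e s - e t| <= K * norm2 (x s - x t).
Hypothesis e_ge0 : forall t, 0 <= e t.
Hypothesis e_decay : {ae lebesgue_measure, forall t, 0 <= t ->
  derivable e t 1 /\
  'D_1 e t <= - (2 * ks * e t `^ ((1 + p) / 2) + 2 * kr * e t `^ ((1 + q) / 2))}.

Lemma energy_nonincreasing (s t : R) : 0 <= s -> s <= t -> e t <= e s.
Proof.
move=> s0 st; have t0 := le_trans s0 st; have [K K0 lip] := lip_e t0.
rewrite -subr_le0 -(mul0r (t - s)).
apply: (absolutely_continuous_growth st (abs_continuous_onS s0 (lexx t) (ac_x t0)) K0).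
  by move=> u v /andP[su ut] /andP[sv vt]; rewrite lip// ?ut ?vt (le_trans s0).
move: e_decay; apply: negligibleS; apply: subsetC => u /= h /andP[su _].
have [de ek] := h (le_trans s0 su); split => //; apply: (le_trans ek).
by rewrite oppr_le0 addr_ge0// mulr_ge0 ?powR_ge0// mulr_ge0// ltW.
Qed.

(** For [a = (1 - p) / 2] resp. [a = (1 - q) / 2] the differential inequality
    bounds [e^a / a] from above by a line of slope [- 2 ks] resp. [- 2 kr], which
    forces [e <= 1] within time [1 / (kr (q - 1))] and then [e = 0] within
    additional time [1 / (ks (1 - p))]. *)
Lemma fixed_time_extinction (t : R) :
  1 / (ks * (1 - p)) + 1 / (kr * (q - 1)) <= t -> e t = 0.
Proof.
set T2 := 1 / (ks * _); set T1 := 1 / (kr * _) => Tt.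
have T10 : 0 < T1 by rewrite divr_gt0// mulr_gt0// subr_gt0.
have T20 : 0 < T2 by rewrite divr_gt0// mulr_gt0// subr_gt0.
apply: contrapT => /eqP et0; have {et0} m0 : 0 < e t.
  by rewrite lt_neqAle eq_sym et0 e_ge0.
have one_powR b : 1 `^ b = 1 :> R by rewrite powR1.
have emM s : 0 <= s <= t -> e t <= e s <= e 0.
  by move=> /andP[s0 st]; rewrite !energy_nonincreasing.
have t0 : 0 <= t by lra.
have [K K0 lip] := lip_e t0.
have decay c d a k : 0 <= c -> c <= d -> d <= t -> a != 0 ->
    (forall s, 2 * k * e s `^ (1 - a) <=
      2 * ks * e s `^ ((1 + p) / 2) + 2 * kr * e s `^ ((1 + q) / 2)) ->
    e d `^ a / a - e c `^ a / a <= - (2 * k) * (d - c).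
  move=> c0 cd dt a0 ka.
  apply: (power_decay cd (abs_continuous_onS c0 dt (ac_x t0)) K0 _ m0 _ a0).
  - by move=> u v /andP[cu ud] /andP[cv vd]; apply: lip; apply/andP; split; lra.
  - by move=> u /andP[cu ud]; apply: emM; apply/andP; split; lra.
  - move: e_decay; apply: negligibleS; apply: subsetC => u /= h /andP[cu _].
    have [de ek] := h (le_trans c0 cu); split => //; apply: (le_trans ek).
    by rewrite lerN2.
have eT1 : e T1 <= 1.
  pose a := (1 - q) / 2; have a0 : a < 0 by move: q1; rewrite /a; lra.
  have a_neq0 : a != 0 by rewrite lt_eqF.
  have T1t : T1 <= t by lra.
  have ka s : 2 * kr * e s `^ (1 - a) <=
      2 * ks * e s `^ ((1 + p) / 2) + 2 * kr * e s `^ ((1 + q) / 2).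
    have -> : 1 - a = (1 + q) / 2 by rewrite /a; field.
    by rewrite lerDr mulr_ge0 ?powR_ge0// mulr_ge0// ltW.
  have := decay 0 T1 a kr (lexx 0) (ltW T10) T1t a_neq0 ka.
  have -> : - (2 * kr) * (T1 - 0) = 1 / a.
    rewrite /T1 /a; field.
    by rewrite !subr_eq0 (lt_eqF q1) (gt_eqF q1) (gt_eqF kr0).
  rewrite -mulrBl ler_ndivrMr// divfK// => eT.
  rewrite leNgt; apply/negP => eT1.
  have : e T1 `^ a <= 1.
    rewrite -(opprK a) powRN invf_le1 ?powR_gt0 ?(lt_trans _ eT1)//.
    rewrite -[leLHS](one_powR (- a)); apply: ge0_ler_powR; rewrite ?nnegrE//.
    - by lra.
    - exact: ltW.
  have : 0 < e 0 `^ a by rewrite powR_gt0// (lt_le_trans m0)// energy_nonincreasing.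
  by lra.
pose a := (1 - p) / 2; have a0 : 0 < a by move: p1; rewrite /a; lra.
have a_neq0 : a != 0 by rewrite gt_eqF.
have ka s : 2 * ks * e s `^ (1 - a) <=
    2 * ks * e s `^ ((1 + p) / 2) + 2 * kr * e s `^ ((1 + q) / 2).
  have -> : 1 - a = (1 + p) / 2 by rewrite /a; field.
  by rewrite lerDl mulr_ge0 ?powR_ge0// mulr_ge0// ltW.
have T1t : T1 <= t by lra.
have := decay T1 t a ks (ltW T10) T1t (lexx t) a_neq0 ka.
have slope : - (2 * ks) * (t - T1) <= - 1 / a.
  have -> : - 1 / a = - (2 * ks) * T2.
    rewrite /T2 /a; field.
    by rewrite !subr_eq0 (gt_eqF p1) (gt_eqF ks0).
  by rewrite ler_wnM2l ?lerBrDr// oppr_le0 mulr_ge0// ltW.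
move=> /le_trans/(_ slope); rewrite -mulrBl ler_pdivrMr// divfK// => et.
have : e T1 `^ a <= 1.
  rewrite -[leRHS](one_powR a); apply: ge0_ler_powR; rewrite ?nnegrE//.
  exact: ltW.
have : 0 < e t `^ a by rewrite powR_gt0.
by lra.
Qed.

End fixed_time.

(** The bounds for [gp] and [gq] are added before they are pulled back along [L],
    because only their sum is assumed to act componentwise. *)
Lemma filippov_dissipation {R : realType} {n : nat} (L : 'M[R]_n.+1)
    (p q sigma rho : R) (g gp gq : 'cV[R]_n.+1 -> 'cV[R]_n.+1) x eta :
  (forall i, exists j, L i j != 0) ->
  (forall y, g y = gp y + gq y) -> componentwise_sign_preserving g ->
  class_F p sigma gp -> class_F q rho gq ->
  filippov (fun z => - g (L *m z)) x eta ->
  dot eta (L *m x) <= - (sigma * norm2 (L *m x) `^ (1 + p) +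
                         rho * norm2 (L *m x) `^ (1 + q)).
Proof.
move=> L0 gE sg [_ bp _ Fp] [_ bq _ Fq]; apply: filippov_comp_mulmx => // e e0.
have e20 : 0 < e / 2 by lra.
have [r [N0 [r0 null0 gr]]] := filippov_ess_lower_bound bp (Fp (L *m x)) e20.
have [s [N1 [s0 null1 gs]]] := filippov_ess_lower_bound bq (Fq (L *m x)) e20.
exists (Num.min r s), (N0 `|` N1); split.
- by rewrite lt_min r0.
- exact: lebesgue_nullU.
- move=> z; rewrite /eball/= lt_min => /andP[zr zs] /not_orP[zN0 zN1].
  rewrite gE dotDl; have := gr z zr zN0; have := gs z zs zN1.
  by lra.
Qed.

Lemma smallest_nonzero_eigenvalue_gt0 {R : realType} {n : nat} (L : 'M[R]_n)
    (lambda : R) :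
  L^T = L -> (forall v : 'cV[R]_n, 0 <= dot v (L *m v)) ->
  smallest_nonzero_eigenvalue L lambda -> 0 < lambda.
Proof.
move=> LT psd [/eigenvalueP[v vL v0] l0 _].
rewrite lt_neqAle eq_sym l0 /=.
have Lv : L *m v^T = lambda *: v^T.
  by rewrite -[in LHS]LT -trmx_mul vL linearZ.
have := psd v^T; rewrite Lv dotZr.
by rewrite pmulr_lge0// dot_gt0// trmx_eq0.
Qed.

Theorem corollary1 (R : realType) (N : nat) (A L : 'M[R]_N)
  (lambda2 p q sigma rho : R) (g gp gq : 'cV[R]_N -> 'cV[R]_N) :
  undirected_graph A -> connected_graph A ->
  L = laplacian A ->
  smallest_nonzero_eigenvalue L lambda2 ->
  (forall y, g y = gp y + gq y) ->
  componentwise_sign_preserving g ->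
  0 <= p < 1 -> 1 < q -> 0 < sigma -> 0 < rho ->
  class_F p sigma gp -> class_F q rho gq ->
  forall x0 : 'cV[R]_N, exists T : R,
    0 <= T <= 1 / (lambda2 * sigma * (1 - p)) + 1 / (lambda2 * rho * (q - 1)) /\
    forall x : R -> 'cV[R]_N,
      filippov_solution (fun z => - g (L *m z)) x -> x 0 = x0 ->
      forall t, T <= t -> consensus (x t).
Proof.
case: N A L g gp gq => [|n] A L g gp gq graphA connA LE gap gE sg /andP[p0 p1] q1
    sigma0 rho0 Fp Fq x0.
  have [/eigenvalueP[v _ v0] _ _] := gap.
  by move: v0; rewrite thinmx0 eqxx.
have LT : L^T = L by rewrite LE laplacian_sym.
have psd (v : 'cV[R]_n.+1) : 0 <= dot v (L *m v) by rewrite LE laplacian_psd.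
have lambda0 := smallest_nonzero_eigenvalue_gt0 LT psd gap.
have [evL _ gapL] := gap.
have L_neq0 : L != 0.
  apply/eqP => L0; move: evL; rewrite L0 => /eigenvalueP[v + v0].
  rewrite mulmx0 => /esym/eqP; rewrite scaler_eq0 (negbTE v0) orbF.
  by rewrite gt_eqF.
have L_row i : exists j, L i j != 0.
  by rewrite LE; apply: laplacian_row_neq0 => //; rewrite -LE.
set T := 1 / _ + 1 / _.
have T0 : 0 <= T.
  by rewrite addr_ge0// divr_ge0// mulr_ge0// ?mulr_ge0 ?ltW//; lra.
exists T; split; first by rewrite T0 lexx.
move=> x [ac_x sol_x] _ t Tt.
pose e s := lambda2 * dot (x s) (L *m x s).
suff et0 : e t = 0.
  move/eqP: et0; rewrite /e mulf_eq0 gt_eqF//= => /eqP.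
  by rewrite LE; apply: laplacian_form_eq0.
apply: (@fixed_time_extinction R n.+1 x e (lambda2 * sigma) (lambda2 * rho) p q
  _ _ _ _ ac_x) => //.
- by rewrite mulr_gt0.
- by rewrite mulr_gt0.
- move=> d d0; have [K K0 lip] := quadratic_form_lipschitz LT d0 (ac_x d d0).
  exists (lambda2 * K); first by rewrite mulr_gt0.
  move=> s u sd ud; rewrite /e -mulrBr normrM gtr0_norm// -mulrA.
  by rewrite ler_wpM2l ?(ltW lambda0)// lip.
- by move=> s; rewrite /e mulr_ge0 ?(ltW lambda0).
move: sol_x; apply: negligibleS; apply: subsetC => s /= h s0.
have [dx Fx] := h s0.
have de : is_derive s 1 e (lambda2 * (2 * dot ('D_1 x s) (L *m x s))).
  by apply: (@is_deriveZ _ _ _ (fun s => dot (x s) (L *m x s)) lambda2);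
    exact: is_derive_quadratic_form.
split; first exact: ex_derive.
rewrite (@derive_val _ _ _ _ _ _ _ de).
have := filippov_dissipation L_row gE sg Fp Fq Fx.
set y := L *m x s => dissipation.
have e_y : e s <= norm2 y ^+ 2 by rewrite norm2_sqr spectral_gap.
have e_pow r : 0 <= r -> e s `^ (r / 2) <= norm2 y `^ r.
  move=> r0; have -> : norm2 y `^ r = (norm2 y ^+ 2) `^ (r / 2).
    by rewrite -powR_mulrn ?norm2_ge0// -powRrM; congr (_ `^ _); field.
  apply: ge0_ler_powR => //.
  - by rewrite divr_ge0.
  - by rewrite nnegrE mulr_ge0// ltW.
  - by rewrite nnegrE sqr_ge0.
have sigma_pow : sigma * e s `^ ((1 + p) / 2) <= sigma * norm2 y `^ (1 + p).
  by rewrite ler_wpM2l ?(ltW sigma0)// e_pow//; lra.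
have rho_pow : rho * e s `^ ((1 + q) / 2) <= rho * norm2 y `^ (1 + q).
  by rewrite ler_wpM2l ?(ltW rho0)// e_pow//; lra.
rewrite (_ : _ + _ = lambda2 * (2 * (sigma * e s `^ ((1 + p) / 2) +
  rho * e s `^ ((1 + q) / 2)))); last by ring.
rewrite -mulrN ler_wpM2l ?(ltW lambda0)//.
by lra.
Qed.
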